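(* Let $f=\frac1n\sum_{i=1}^n f_i$ with $f_i:\mathbb{R}^d\to\mathbb{R}$ differentiable. Suppose that $f$ is $L$-smooth, that each $f_i$ is $L_i$-smooth with $L_{\max}=\max_i L_i$, that each $f_i$ is convex, and that $f$ is $\mu$-strongly convex with $\mu\ge0$ and attains a minimum at some point $x^*\in\mathbb{R}^d$. Suppose that for all $x\in\mathbb{R}^d$ the stochastic gradients $\widetilde\nabla f_i(x)$ are unbiased and have bounded variance, i.e. $\mathrm{E}[\widetilde\nabla f_i(x)]=\nabla f_i(x)$ and $\mathrm{E}[\|\widetilde\nabla f_i(x)-\nabla f_i(x)\|^2]\le\sigma^2$ for all $i\in\{1,\dots,n\}$, where $\sigma^2\ge0$. Consider the algorithm EF21-P + DIANA (described in the context) using the stochastic gradients $\widetilde\nabla f_i$ instead of the exact gradients $\nabla f_i$ for all $i$, with compressors $\mathcal{C}_i^D\in\mathbb{U}(\omega)$, $\mathcal{C}^P\in\mathbb{B}(\alpha)$, with $\beta=\frac1{\omega+1}$, $x^0=w^0$, and $$\gamma\le\min\left\{\frac{n}{160\,\omega L_{\max}},\ \frac{\alpha}{100L},\ \frac{1}{(\omega+1)\mu}\right\}.$$ Then the algorithm returns $x^T$ such that $$\frac{1}{2\gamma}\mathrm{E}\left[\|x^T-x^*\|^2\right]+\mathrm{E}\left[f(x^T)-f(x^* )\right]\le\left(1-\frac{\gamma\mu}{2}\right)^T V^0+\frac{24(\omega+1)\sigma^2}{\mu n},$$ where $$V^0:=\frac{1}{2\gamma}\mathrm{E}\left[\|x^0-x^*\|^2\right]+\left(f(x^0)-f(x^*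 )\right)+\frac{8\gamma\omega(\omega+1)}{n^2}\sum_{i=1}^n\|h_i^0-\nabla f_i(x^* )\|^2 .$$
   Context: $\|\cdot\|$ is the Euclidean norm. A function $\varphi$ is $L$-smooth if it is differentiable with $\|\nabla \varphi(x)-\nabla \varphi(y)\|\le L\|x-y\|$ for all $x,y\in\mathbb{R}^d$; the constants $L$ and $L_i$ denote the smallest such numbers for $f$ and $f_i$. Fractions with zero denominator in upper bounds are read as $+\infty$. Compressors. For $\alpha\in(0,1]$, $\mathbb{B}(\alpha)$ is the set of (possibly) stochastic mappings $\mathcal{C}:\mathbb{R}^d\to\mathbb{R}^d$ with $\mathrm{E}[\|\mathcal{C}(x)-x\|^2]\le(1-\alpha)\|x\|^2$ for all $x\in\mathbb{R}^d$. For $\omega\ge0$, $\mathbb{U}(\omega)$ is the set of stochastic mappings $\mathcal{C}:\mathbb{R}^d\to\mathbb{R}^d$ with $\mathrm{E}[\mathcal{C}(x)]=x$ and $\mathrm{E}[\|\mathcal{C}(x)-x\|^2]\le\omega\|x\|^2$ for all $x\in\mathbb{R}^d$. Algorithm EF21-P + DIANA with stochastic gradients. Parameters: learning rates $\gamma>0$ and $\beta>0$, initial model $x^0\in\mathbb{R}^d$, initial model shift $w^0=x^0$, initial gradient shifts $h_1^0,\dots,h_n^0\in\mathbb{R}^d$, and $h^0=\frac1n\sum_{i=1}^n h_i^0$. For $t=0,1,\dots,T-1$: $m_i^t=\mathcal{C}_i^D(\widetilde\nabla f_i(w^t)-h_i^t)$ and $h_i^{t+1}=h_i^t+\beta m_i^t$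 for $i=1,\dots,n$; $m^t=\frac1n\sum_{i=1}^n m_i^t$; $h^{t+1}=h^t+\beta m^t$; $g^t=h^t+m^t$; $x^{t+1}=x^t-\gamma g^t$; $w^{t+1}=w^t+\mathcal{C}^P(x^{t+1}-w^t)$. *)

(* Defs.v *)
From HB Require Import structures.
From mathcomp Require Import all_boot all_order all_algebra.
From mathcomp Require Import all_classical all_reals all_analysis.

Set Implicit Arguments.
Unset Strict Implicit.
Unset Printing Implicit Defensive.
Import Order.TTheory GRing.Theory Num.Theory.
Import numFieldNormedType.Exports.

Local Open Scope classical_set_scope.
Local Open Scope ring_scope.

(* The library norm `|x| on 'rV[R]_d is the sup norm; it induces the same
   topology, hence the same notion of differentiability. *)
Definition enorm (R : realType) (d : nat) (x : 'rV[R]_d) : R :=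
  Num.sqrt (\sum_(j < d) x 0 j ^+ 2).

Definition grad (R : realType) (d : nat) (f : 'rV[R]_d -> R) (x : 'rV[R]_d) :
    'rV[R]_d :=
  \row_(j < d) 'D_(delta_mx 0 j) (f : 'rV[R]_d -> R^o) x.

Definition differentiable_everywhere (R : realType) (d : nat)
    (f : 'rV[R]_d -> R) : Prop :=
  forall x : 'rV[R]_d, differentiable (f : 'rV[R]_d -> R^o) x.

Definition smooth (R : realType) (d : nat) (L : R) (f : 'rV[R]_d -> R) : Prop :=
  differentiable_everywhere f /\
  forall x y : 'rV[R]_d, enorm (grad f x - grad f y) <= L * enorm (x - y).

Definition smoothness_constant (R : realType) (d : nat) (L : R)
    (f : 'rV[R]_d -> R) : Prop :=
  smooth L f /\ forall L' : R, smooth L' f -> L <= L'.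

Definition strongly_convex (R : realType) (d : nat) (mu : R)
    (f : 'rV[R]_d -> R) : Prop :=
  forall (x y : 'rV[R]_d) (t : R), 0 <= t <= 1 ->
    f (t *: x + (1 - t) *: y) <=
      t * f x + (1 - t) * f y - mu / 2 * (t * (1 - t)) * enorm (x - y) ^+ 2.

Definition average (R : realType) (n d : nat) (f : 'I_n -> 'rV[R]_d -> R)
    (x : 'rV[R]_d) : R :=
  n%:R^-1 * \sum_(i < n) f i x.

(* A fraction occurring in an upper bound: +oo when the denominator is 0. *)
Definition ubfrac (R : realType) (a b : R) : \bar R :=
  if b == 0 then +oo%E else (a / b)%:E.

Definition borel (R : realType) (d : nat) :=
  g_sigma_algebraType (@open 'rV[R]_d).

(* A stochastic mapping of R^d is a function of a point and of a random seed.
   Joint measurability makes its value at a random point, drawn with an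
   independent seed, a random vector. *)
Record stoch_map (R : realType) (d : nat) := StochMap {
  seed_display : measure_display ;
  seed : measurableType seed_display ;
  seed_law : probability seed R ;
  draw : seed -> 'rV[R]_d -> 'rV[R]_d ;
  measurable_draw :
    measurable_fun [set: seed * borel R d]
      (fun p : seed * borel R d => draw p.1 p.2 : borel R d)
}.
Arguments draw {R d} s _ _.

Definition unbiased (R : realType) (d : nat) (C : stoch_map R d)
    (F : 'rV[R]_d -> 'rV[R]_d) : Prop :=
  forall (x : 'rV[R]_d) (j : 'I_d),
    (seed_law C).-integrable [set: seed C] (fun s => (draw C s x 0 j)%:E) /\
    ('E_(seed_law C)[fun s => (draw C s x 0 j)%R])%E = (F x 0 j)%:E.

Definition mean_sq_error (R : realType) (d : nat) (C : stoch_map R d)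
    (F : 'rV[R]_d -> 'rV[R]_d) (x : 'rV[R]_d) : \bar R :=
  ('E_(seed_law C)[fun s => (enorm (draw C s x - F x) ^+ 2)%R])%E.

(* The class B(alpha). *)
Definition contractive (R : realType) (d : nat) (alpha : R)
    (C : stoch_map R d) : Prop :=
  forall x : 'rV[R]_d,
    (mean_sq_error C id x <= ((1 - alpha) * enorm x ^+ 2)%:E)%E.

(* The class U(omega). *)
Definition unbiased_compressor (R : realType) (d : nat) (omega : R)
    (C : stoch_map R d) : Prop :=
  unbiased C id /\
  forall x : 'rV[R]_d, (mean_sq_error C id x <= (omega * enorm x ^+ 2)%:E)%E.

Definition mutually_independent (dO : measure_display) (O : measurableType dO)
    (R : realType) (P : probability O R) (I : choiceType)
    (dS : I -> measure_display) (S : forall i, measurableType (dS i))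
    (X : forall i, {RV P >-> S i}) : Prop :=
  forall (J : seq I) (A : forall i, set (S i)),
    uniq J -> (forall i, measurable (A i)) ->
    P (\bigcap_(i in [set` J]) (X i @^-1` A i)) =
    (\big[*%E/1%E]_(i <- J) P (X i @^-1` A i)).

(* The sources of randomness of one iteration: the stochastic gradients
   (inl (inl i)), the compressors C_i^D (inl (inr i)) and C^P (inr tt). *)
Definition source (n : nat) : choiceType := ('I_n + 'I_n + unit)%type.

Definition source_map (R : realType) (n d : nat) (G CD : 'I_n -> stoch_map R d)
    (CP : stoch_map R d) (k : source n) : stoch_map R d :=
  match k with
  | inl (inl i) => G i
  | inl (inr i) => CD i
  | inr _ => CP
  end.

(* In the first T iterations every mapping is evaluated with a fresh seed. *)
Definition fresh_seeds (dO : measure_display) (O : measurableType dO)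
    (R : realType) (P : probability O R) (n d T : nat)
    (M : source n -> stoch_map R d)
    (xi : nat -> forall k : source n, {RV P >-> seed (M k)}) : Prop :=
  (forall (t : nat) (k : source n) (A : set (seed (M k))),
      (t < T)%N -> measurable A -> distribution P (xi t k) A = seed_law (M k) A) /\
  mutually_independent (fun tk : 'I_T * source n => xi tk.1 tk.2).

Record state (R : realType) (n d : nat) := State {
  model : 'rV[R]_d ;                (* x^t *)
  model_shift : 'rV[R]_d ;          (* w^t *)
  grad_shift : 'I_n -> 'rV[R]_d ;   (* h_i^t *)
  mean_shift : 'rV[R]_d             (* h^t *)
}.

Definition diana_init (R : realType) (n d : nat) (x0 : 'rV[R]_d)
    (h0 : 'I_n -> 'rV[R]_d) : state R n d :=
  State x0 x0 h0 (n%:R^-1 *: \sum_(i < n) h0 i).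

Definition diana_step (R : realType) (n d : nat) (gamma beta : R)
    (G CD : 'I_n -> 'rV[R]_d -> 'rV[R]_d) (CP : 'rV[R]_d -> 'rV[R]_d)
    (s : state R n d) : state R n d :=
  let w := model_shift s in
  let m := fun i => CD i (G i w - grad_shift s i) in
  let mbar := n%:R^-1 *: \sum_(i < n) m i in
  let g := mean_shift s + mbar in
  let x' := model s - gamma *: g in
  State x' (w + CP (x' - w))
    (fun i => grad_shift s i + beta *: m i) (mean_shift s + beta *: mbar).

Fixpoint diana (dO : measure_display) (O : measurableType dO)
    (R : realType) (P : probability O R) (n d : nat) (gamma beta : R)
    (G CD : 'I_n -> stoch_map R d) (CP : stoch_map R d)
    (xi : nat -> forall k : source n, {RV P >-> seed (source_map G CD CP k)})
    (x0 : 'rV[R]_d) (h0 : 'I_n -> 'rV[R]_d) (t : nat) (o : O) : state R n d :=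
  match t with
  | 0%N => diana_init x0 h0
  | u.+1 =>
      diana_step gamma beta
        (fun i => draw (G i) (xi u (inl (inl i)) o))
        (fun i => draw (CD i) (xi u (inl (inr i)) o))
        (draw CP (xi u (inr tt) o))
        (diana gamma beta xi x0 h0 u o)
  end.

(* Main.v *)
(* Lyapunov argument. With a_i = grad f_i (z), z the minimizer, put
     V = |x - z|^2 / (2 gamma) + (f x - f z)
         + K sum_i |h_i - a_i|^2 + nu |w - x|^2,
   where K = 8 gamma omega (omega + 1) / n^2 and nu = 3 L / alpha.  One
   iteration satisfies
     E V^{t+1} <= (1 - gamma mu / 2) E V^t + 12 gamma (omega + 1) sigma^2 / n,
   and the additive term is (gamma mu / 2) times the constant of the theorem;
   the last summand of V vanishes at t = 0 because w^0 = x^0.  When mu = 0 the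
   right-hand side is infinite.

   The drift inequality only needs Tonelli's theorem for nonnegative functions.
   The seeds are integrated out one at a time, from the latest to the earliest,
   each against the sigma-algebra of the seeds drawn before it.  After C^P, the
   smoothness of f bounds V^{t+1} by a function which is quadratic in every
   message m_i; a quadratic function with leading coefficient c of a random
   vector with mean m and variance at most v has expectation at most its value
   at m plus c v, so each message is in turn replaced by its conditional mean
   grad f_i (w) - h_i.  What remains is a deterministic inequality. *)

Require Import Defs.
From HB Require Import structures.
From mathcomp Require Import all_boot all_order all_algebra.
From mathcomp Require Import all_classical all_reals all_analysis.
From mathcomp Require Import measurable_realfun ring lra.
Import Order.TTheory GRing.Theory Num.Theory.
Import numFieldNormedType.Exports.
Local Open Scope classical_set_scope.
Local Open Scope ring_scope.

Set Implicit Arguments.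
Unset Strict Implicit.
Unset Printing Implicit Defensive.

(** * Euclidean inner product and gradients *)

Section Euclidean.
Context {R : realType} {d : nat}.
Implicit Types u v w x y : 'rV[R]_d.

Definition dot u v : R := \sum_(j < d) u 0 j * v 0 j.

Lemma dotC u v : dot u v = dot v u.
Proof. by apply: eq_bigr => j _; rewrite mulrC. Qed.

Lemma dotDl u v w : dot (u + v) w = dot u w + dot v w.
Proof. by rewrite /dot -big_split; apply: eq_bigr => j _; rewrite mxE mulrDl. Qed.

Lemma dotDr u v w : dot u (v + w) = dot u v + dot u w.
Proof. by rewrite !(dotC u) dotDl. Qed.

Lemma dotZl k u v : dot (k *: u) v = k * dot u v.
Proof. by rewrite /dot mulr_sumr; apply: eq_bigr => j _; rewrite mxE mulrA. Qed.

Lemma dotZr k u v : dot u (k *: v) = k * dot u v.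
Proof. by rewrite dotC dotZl dotC. Qed.

Lemma dotNl u v : dot (- u) v = - dot u v.
Proof. by rewrite -scaleN1r dotZl mulN1r. Qed.

Lemma dotNr u v : dot u (- v) = - dot u v.
Proof. by rewrite dotC dotNl dotC. Qed.

Lemma dot0l v : dot 0 v = 0.
Proof. by rewrite -(scale0r 0) dotZl mul0r. Qed.

Definition dotE := (dotDl, dotDr, dotZl, dotZr, dotNl, dotNr).

Lemma dot_suml (I : Type) (r : seq I) (F : I -> 'rV[R]_d) v :
  dot (\sum_(i <- r) F i) v = \sum_(i <- r) dot (F i) v.
Proof.
by elim/big_ind2 : _ => [|? ? ? ? <- <-|//]; rewrite ?dot0l ?dotDl.
Qed.

Lemma dot_ge0 u : 0 <= dot u u.
Proof. by apply: sumr_ge0 => j _; rewrite -expr2 sqr_ge0. Qed.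

Lemma dot_eq0 u : dot u u = 0 -> u = 0.
Proof.
move=> /eqP; rewrite psumr_eq0 => [/allP u0|j _]; last by rewrite -expr2 sqr_ge0.
apply/rowP => j; have := u0 j (mem_index_enum _).
by rewrite mulf_eq0 orbb mxE => /eqP.
Qed.

Lemma enorm_ge0 u : 0 <= enorm u.
Proof. exact: sqrtr_ge0. Qed.

Lemma enorm_sqr u : enorm u ^+ 2 = dot u u.
Proof. by rewrite sqr_sqrtr//; apply: sumr_ge0 => j _; rewrite sqr_ge0. Qed.

Lemma enorm_sqrM (L : R) u v :
  enorm u <= L * enorm v -> dot u u <= L ^+ 2 * dot v v.
Proof.
move=> uv; rewrite -!enorm_sqr -exprMn.
by rewrite ler_pXn2r ?nnegrE ?enorm_ge0// (le_trans (enorm_ge0 u)).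
Qed.

(** Young's inequality: expand the nonnegative square of [a *: u - v] and divide by [a]. *)
Lemma dot_le_sqr (a : R) u v : 0 < a ->
  2 * dot u v <= a * dot u u + a^-1 * dot v v.
Proof.
move=> a0; have := dot_ge0 (a *: u - v); rewrite !dotE (dotC v u) => h.
rewrite -(ler_pM2l a0) mulrDr mulrA (mulrA a a^-1) divff ?gt_eqF// mul1r.
by lra.
Qed.

(** A form of Cauchy-Schwarz free of square roots: Young's inequality with weight [L^-1]. For
    [L = 0] the vector [u] vanishes. *)
Lemma dot_le_lipschitz (L : R) u v : 0 <= L ->
  dot u u <= L ^+ 2 * dot v v -> dot u v <= L * dot v v.
Proof.
rewrite le_eqVlt => /predU1P[<-|L0] h.
  rewrite (@dot_eq0 u) ?dot0l ?mul0r//; apply/eqP.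
  by rewrite eq_le dot_ge0 andbT; move: h; rewrite expr0n mul0r.
have := @dot_le_sqr L^-1 u v; rewrite invr_gt0 invrK => /(_ L0).
have : L^-1 * dot u u <= L * dot v v by rewrite ler_pdivrMl// mulrA -expr2.
by lra.
Qed.

Lemma dot_coord_le u j : u 0 j ^+ 2 <= dot u u.
Proof.
rewrite /dot (bigD1 j)//= -expr2 lerDl; apply: sumr_ge0 => k _.
by rewrite -expr2 sqr_ge0.
Qed.

End Euclidean.

(** * Directional derivatives and the descent inequality *)

Section Gradient.
Context {R : realType} {d : nat}.
Implicit Types (f : 'rV[R]_d -> R) (u v w x y : 'rV[R]_d).

(** [grad] only records the partial derivatives; linearity of the differential recovers every other
    direction from them. *)
Lemma derive_grad f x v : differentiable (f : 'rV[R]_d -> R^o) x ->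
  'D_v (f : 'rV[R]_d -> R^o) x = dot (grad f x) v.
Proof.
move=> df; rewrite deriveE// [v in LHS]row_sum_delta linear_sum /dot.
apply: eq_bigr => j _; rewrite linearZ /= -deriveE// mxE.
by rewrite mulrC.
Qed.

Lemma is_derive_line f x v (t : R) : differentiable_everywhere f ->
  is_derive t (1 : R) (fun s : R => f (x + s *: v) : R^o)
    (dot (grad f (x + t *: v)) v).
Proof.
move=> df.
have dl : is_diff t (fun s : R => x + s *: v) (fun s => s *: v).
  have := @is_diffD R R^o 'rV[R]_d (cst x) ( *:%R^~ v) 0 ( *:%R^~ v) t
   (is_diff_cst _ _) (is_diff_scalel _ _).
  by rewrite add0r.
have dfl : differentiable (f : 'rV[R]_d -> R^o) (x + t *: v) by exact: df.
have dlt : differentiable (fun s : R^o => x + s *: v) t by case: dl.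
have dc : differentiable ((f : 'rV[R]_d -> R^o) \o (fun s : R^o => x + s *: v)) t.
  exact: differentiable_comp.
have dd : derivable ((f : 'rV[R]_d -> R^o) \o (fun s : R^o => x + s *: v)) t 1.
  exact: diff_derivable.
apply: DeriveDef => //.
rewrite (deriveE _ dc) diff_comp//= -derive_grad// deriveE//.
by rewrite (@diff_val _ _ _ _ _ _ _ dl) scale1r.
Qed.

(** The descent lemma, proved without integration: along the segment from [x] to [y], the function
    minus the quadratic [q] has nonpositive derivative, hence is no larger at 1 than at 0. *)
Lemma smooth_upper_bound (L : R) f x y : 0 <= L -> smooth L f ->
  f y <= f x + dot (grad f x) (y - x) + L / 2 * dot (y - x) (y - x).
Proof.
move=> L0 [df lf]; set v := y - x.
pose q (s : R) : R := s * dot (grad f x) v + L / 2 * dot v v * s ^+ 2.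
pose dq (s : R) : R := dot (grad f x) v + L / 2 * dot v v * (2 * s).
have iq s : is_derive s (1:R) q (dq s).
  have -> : q = dot (grad f x) v \*: (id : R -> R^o)
      + (L / 2 * dot v v) \*: ((id : R -> R) ^+ 2 : R -> R^o).
    by apply/funext => r; rewrite /q !fctE /= /GRing.scale /=; ring.
  by apply: is_derive_eq; rewrite /dq /GRing.scale /=; ring.
pose h (s : R) : R := f (x + s *: v) - q s.
have ih s : is_derive s (1:R) h (dot (grad f (x + s *: v)) v - dq s).
  exact: (is_deriveB (is_derive_line x v s df) (iq s)).
have : h 1 <= h 0.
  apply: (@ler0_derive1_le_cc _ h 0 1) => //.
  - move=> s; rewrite in_itv /= => /andP[s0 _]; rewrite derive1E.
    rewrite (@derive_val _ _ _ _ _ _ _ (ih s)) /dq.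
    have := lf (x + s *: v) x; rewrite addrAC subrr add0r => /enorm_sqrM.
    rewrite dotZl dotZr => /[dup] _ le1.
    (* The displacement is [s *: v], so relative to [v] itself the Lipschitz constant is [L * s],
       which matches the derivative of the quadratic term of [q]. *)
    have := @dot_le_lipschitz _ _ (L * s) (grad f (x + s *: v) - grad f x) v.
    rewrite mulr_ge0// ?(ltW s0)// => /(_ isT).
    have -> : (L * s) ^+ 2 * dot v v = L ^+ 2 * (s * (s * dot v v)) by ring.
    by move=> /(_ le1); rewrite dotDl dotNl; lra.
  - by apply: continuous_subspaceT => s; apply: differentiable_continuous;
      apply/derivable1_diffP; case: (ih s).
  - by rewrite in_itv /= lexx ler01.
  - by rewrite in_itv /= lexx ler01.
by rewrite /h /q scale1r scale0r addr0 /v [x + _]addrC subrK; lra.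
Qed.

End Gradient.

(** * Smooth and convex functions *)

Section ConvexSmooth.
Context {R : realType} {d : nat}.
Implicit Types (f : 'rV[R]_d -> R) (u v w x y : 'rV[R]_d).

(** Strong convexity at [h *: y + (1 - h) *: x], divided by [h], bounds the difference quotient in
    the direction [y - x]; then [h] tends to 0 from the right. *)
Lemma strongly_convex_lower_bound (mu : R) f x y :
  differentiable_everywhere f -> strongly_convex mu f ->
  f x + dot (grad f x) (y - x) + mu / 2 * dot (y - x) (y - x) <= f y.
Proof.
move=> df cf; set v := y - x.
have cvgF : h^-1 *: ((f (h *: v + x) : R^o) - f x) @[h --> 0^'+] -->
    dot (grad f x) v.
  rewrite -derive_grad; last exact: df.
  have /(_ v) dv : forall v, derivable (f : 'rV[R]_d -> R^o) x v.
    by move=> u; exact: diff_derivable.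
  have := @cvg_dnbhs_at_right _ _ _ _ _ dv.
  exact.
set c := f y - f x - mu / 2 * dot v v.
(* After division by [h] the factor [h * (1 - h)] becomes [1 - h]: its constant part is in [c], and
   the rest is this vanishing term. *)
have cvgG : c + mu / 2 * dot v v * h @[h --> 0^'+] --> c.
  suff : c + mu / 2 * dot v v * h @[h --> 0^'+] --> c + mu / 2 * dot v v * 0.
    by rewrite mulr0 addr0.
  apply: cvgD; first exact: cvg_cst.
  by apply: cvgMl_tmp; apply: cvg_at_right_filter; exact: cvg_id.
have : dot (grad f x) v <= c.
  apply: (ler_cvg_to cvgF cvgG); near=> h.
  have h0 : 0 < h by near: h; exact: nbhs_right_gt.
  have h1 : h <= 1 by near: h; apply: nbhs_right_le.
  have := cf y x h; rewrite (ltW h0) h1 => /(_ isT).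
  rewrite -/v enorm_sqr.
  have -> : h *: y + (1 - h) *: x = h *: v + x.
    by rewrite /v scalerBr scalerBl scale1r addrA addrAC.
  rewrite /GRing.scale /= => hc.
  rewrite -(ler_pM2l h0) mulrA divff ?gt_eqF// mul1r /c.
  by nra.
by rewrite /c; lra.
Unshelve. all: by end_near. Qed.

Lemma convex_function_strongly_convex0 f :
  convex_function [set: 'rV[R]_d] f -> strongly_convex 0 f.
Proof.
move=> cf x y t /andP[t0 t1]; rewrite mul0r mul0r mul0r subr0.
pose s := Itv01 t0 t1.
have := cf s x y; rewrite !inE => /(_ Logic.I Logic.I).
by rewrite /= /conv /=.
Qed.

(** At the test point [x - L^-1 *: g], the smoothness upper bound from [x] is compared with the
    convexity lower bound from [y]. The case [L = 0] is separate, the gradient being constant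
    there. *)
Lemma cocoercive (L : R) f x y : 0 <= L -> smooth L f -> strongly_convex 0 f ->
  dot (grad f x - grad f y) (grad f x - grad f y) <=
  2 * L * (f x - f y - dot (grad f y) (x - y)).
Proof.
move=> L0 Lf cf; set g := grad f x - grad f y.
have [L00|Ln0] := eqVneq L 0.
  have := enorm_sqrM (Lf.2 x y); rewrite -/g L00 expr0n mulr0 !mul0r.
  exact.
have {Ln0}L0' : 0 < L by rewrite lt_neqAle eq_sym Ln0.
have lo := strongly_convex_lower_bound y (x - L^-1 *: g) Lf.1 cf.
have up := smooth_upper_bound x (x - L^-1 *: g) L0 Lf.
have : f y + dot (grad f y) (x - y) + L^-1 / 2 * dot g g <= f x.
  have E1 : x - L^-1 *: g - x = - (L^-1 *: g) by rewrite addrC addKr.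
  have E2 : x - L^-1 *: g - y = (x - y) - L^-1 *: g by rewrite addrAC.
  have gE : grad f x = grad f y + g by rewrite [RHS]addrC subrK.
  clearbody g.
  move: up lo; rewrite E1 E2 gE !dotE.
  have E4 : L / 2 * (L^-1 * (L^-1 * dot g g)) = L^-1 / 2 * dot g g.
    by field; rewrite gt_eqF.
  rewrite ?(mulrN, mulNr, opprK) E4; lra.
rewrite -(ler_pM2l (_ : 0 < 2 * L)) ?mulr_gt0// => h.
have E5 : 2 * L * (L^-1 / 2 * dot g g) = dot g g by field; rewrite gt_eqF.
by lra.
Qed.

(** A gradient step of size [L^-1] from [x] decreases [f] by at least the squared gradient over
    [2 * L], yet cannot go below the minimum. *)
Lemma grad_sqr_le (L : R) f xs x : 0 < L -> smooth L f ->
  (forall z, f xs <= f z) -> dot (grad f x) (grad f x) <= 2 * L * (f x - f xs).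
Proof.
move=> L0 Lf fmin; set g := grad f x.
have := smooth_upper_bound x (x - L^-1 *: g) (ltW L0) Lf.
have -> : x - L^-1 *: g - x = - (L^-1 *: g) by rewrite addrC addKr.
rewrite -/g !dotE ?(mulrN, mulNr, opprK).
have -> : L / 2 * (L^-1 * (L^-1 * dot g g)) = L^-1 / 2 * dot g g by field; rewrite gt_eqF.
have := fmin (x - L^-1 *: g) => h1 h2.
have : L^-1 / 2 * dot g g <= f x - f xs by lra.
rewrite -(ler_pM2l (_ : 0 < 2 * L)) ?mulr_gt0// => h.
have E5 : 2 * L * (L^-1 / 2 * dot g g) = dot g g by field; rewrite gt_eqF.
by lra.
Qed.

Lemma grad_minimizer (L : R) f xs : 0 < L -> smooth L f ->
  (forall z, f xs <= f z) -> grad f xs = 0.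
Proof.
move=> L0 Lf fmin; apply: dot_eq0; apply/eqP.
rewrite eq_le dot_ge0 andbT.
by have := grad_sqr_le xs L0 Lf fmin; rewrite subrr mulr0.
Qed.

Lemma dot_const1 : (0 < d)%N -> 0 < dot (const_mx 1 : 'rV[R]_d) (const_mx 1).
Proof.
move=> d0; rewrite /dot (eq_bigr (fun=> 1)); last first.
  by move=> j _; rewrite !mxE mulr1.
by rewrite big_const_ord iter_addr_0 ltr0n.
Qed.

Lemma smooth_ge0 (L : R) f : (0 < d)%N -> smooth L f -> 0 <= L.
Proof.
move=> d0 [_ /(_ (const_mx 1) 0)]; rewrite subr0 => h.
have e0 : 0 < enorm (const_mx 1 : 'rV[R]_d).
  rewrite lt_neqAle enorm_ge0 andbT eq_sym; apply/eqP => e0.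
  by have := dot_const1 d0; rewrite -enorm_sqr e0 expr0n ltxx.
by rewrite -(pmulr_lge0 _ e0); apply: le_trans h; exact: enorm_ge0.
Qed.

(** The quadratic lower and upper bounds are compared between 0 and the all-ones vector, which is
    nonzero since [d] is positive. *)
Lemma strong_convexity_le_smoothness (mu L : R) f : (0 < d)%N ->
  smooth L f -> strongly_convex mu f -> mu <= L.
Proof.
move=> d0 Lf cf.
have := strongly_convex_lower_bound 0 (const_mx 1) Lf.1 cf.
have := smooth_upper_bound 0 (const_mx 1) (smooth_ge0 d0 Lf) Lf.
rewrite subr0 => up lo.
have : mu / 2 * dot (const_mx 1 : 'rV[R]_d) (const_mx 1)
    <= L / 2 * dot (const_mx 1 : 'rV[R]_d) (const_mx 1) by lra.
by rewrite ler_pM2r ?dot_const1//; lra.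
Qed.

Lemma grad_average n (f : 'I_n -> 'rV[R]_d -> R) x :
  (forall i, differentiable_everywhere (f i)) ->
  grad (average f) x = n%:R^-1 *: \sum_i grad (f i) x.
Proof.
move=> df; apply/rowP => j; rewrite !mxE summxE.
have -> : (average f : 'rV[R]_d -> R^o) = n%:R^-1 \*: (\sum_i (f i : _ -> R^o)).
  by apply/funext => y; rewrite /average fct_sumE.
have dfi i : derivable (f i : 'rV[R]_d -> R^o) x (delta_mx 0 j).
  by apply: diff_derivable; exact: df.
rewrite deriveZ; last exact: derivable_sum.
rewrite derive_sum//; congr (_ * _).
by apply: eq_bigr => i _; rewrite mxE.
Qed.

End ConvexSmooth.

(** * Borel measurability of random vectors *)

Section BorelVectors.
Context {R : realType} {d : nat}.

Lemma measurable_continuous_borel (g : 'rV[R]_d -> R) :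
  continuous g -> measurable_fun [set: borel R d] (g : borel R d -> R).
Proof.
move=> /continuousP cg; apply: (measurability _ (RGenOpens.measurableE R)).
move=> _ [_ [a [b ->] <-]]; rewrite setTI.
by apply: sub_sigma_algebra; apply: cg; exact: interval_open.
Qed.

Definition box (q : 'rV[R]_d) (r : R) : set 'rV[R]_d :=
  [set y | forall j, `|y 0 j - q 0 j| < r].

(** Boxes with rational centre and radius form a countable base; a radius below [e / 2] and a centre
    within that radius of [x] keep the box inside the ball of radius [e]. *)
Lemma open_rational_boxes (U : set 'rV[R]_d) : open U ->
  U = \bigcup_(k in [set k : 'rV[rat]_d * rat |
         box (map_mx ratr k.1) (ratr k.2) `<=` U])
        box (map_mx ratr k.1) (ratr k.2).
Proof.
move=> oU; apply/seteqP; split=> [x Ux|x [k kU kx]]; last exact: kU.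
have /nbhs_ballP[e /= e0 eU] : nbhs x U by exact: open_nbhs_nbhs.
have [r] : exists r : rat, (ratr r : R) \in `]0, e / 2[.
  by apply: rat_in_itvoo; rewrite divr_gt0.
rewrite in_itv /= => /andP[r0 re].
have /choice[q qP] (j : 'I_d) : exists q : rat, `|x 0 j - ratr q| < ratr r :> R.
  have [q] : exists q : rat, (ratr q : R) \in `]x 0 j - ratr r, x 0 j + ratr r[.
    by apply: rat_in_itvoo; lra.
  by rewrite in_itv /= => qx; exists q; rewrite distrC ltr_distl.
exists (\row_j q j, r) => /=; last by move=> j; rewrite !mxE.
move=> y yq; apply: eU; split=> // i j.
rewrite /ball /= ord1 -(subrKA (ratr (q j))) (le_lt_trans (ler_normD _ _))//.
have := yq j; rewrite !mxE distrC => yqj; have := qP j; lra.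
Qed.

Context d' (T : measurableType d').
Implicit Types f g : T -> 'rV[R]_d.

(** [borel] is generated by the open sets, not by the coordinates. By the countable base it suffices
    to treat boxes, whose preimages are finite intersections of coordinate preimages. *)
Lemma measurable_coordP f :
  measurable_fun [set: T] (f : T -> borel R d) <->
  forall j, measurable_fun [set: T] (fun t => f t 0 j).
Proof.
split=> [mf j|mf].
  exact: (measurableT_comp (measurable_continuous_borel (@coord_continuous _ _ _ 0 j)) mf).
apply: (@measurability _ _ _ (borel R d) _ _ (@open 'rV[R]_d)) => //.
move=> _ [U oU <-]; rewrite setTI (open_rational_boxes oU) preimage_bigcup.
rewrite bigcup_mkcond; apply: countable_bigcupT_measurable => // k.
case: ifPn => // _.
have -> : f @^-1` box (map_mx ratr k.1) (ratr k.2) =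
    \bigcap_(j in [set: 'I_d])
      ((fun t => f t 0 j) @^-1` ball (ratr (k.1 0 j) : R) (ratr k.2)).
  apply/seteqP; split=> t /= ht j; last by have := ht j I; rewrite /ball /= distrC mxE.
  by move=> _; have := ht j; rewrite /ball /= distrC mxE.
apply: fin_bigcap_measurable => // j _; rewrite -[X in measurable X]setTI.
by apply: mf => //; exact: measurable_ball.
Qed.

Lemma borel_measurable_cst (v : 'rV[R]_d) :
  measurable_fun [set: T] (fun=> v : borel R d).
Proof. exact: measurable_cst. Qed.

Lemma borel_measurableD f g :
  measurable_fun [set: T] (f : T -> borel R d) ->
  measurable_fun [set: T] (g : T -> borel R d) ->
  measurable_fun [set: T] (fun t => f t + g t : borel R d).
Proof.
move=> /measurable_coordP mf /measurable_coordP mg; apply/measurable_coordP => j.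
by under eq_fun do rewrite mxE; exact: measurable_funD.
Qed.

Lemma borel_measurableZ (k : R) f :
  measurable_fun [set: T] (f : T -> borel R d) ->
  measurable_fun [set: T] (fun t => k *: f t : borel R d).
Proof.
move=> /measurable_coordP mf; apply/measurable_coordP => j.
by under eq_fun do rewrite mxE; exact: measurable_funM.
Qed.

Lemma borel_measurableB f g :
  measurable_fun [set: T] (f : T -> borel R d) ->
  measurable_fun [set: T] (g : T -> borel R d) ->
  measurable_fun [set: T] (fun t => f t - g t : borel R d).
Proof.
move=> mf mg; apply: borel_measurableD => //.
by under eq_fun do rewrite -scaleN1r; exact: borel_measurableZ.
Qed.

Lemma borel_measurable_sum (I : Type) (r : seq I) (F : I -> T -> 'rV[R]_d) :
  (forall i, measurable_fun [set: T] (F i : T -> borel R d)) ->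
  measurable_fun [set: T] (fun t => \sum_(i <- r) F i t : borel R d).
Proof.
move=> mF; elim: r => [|i r ih].
  by under eq_fun do rewrite big_nil; exact: borel_measurable_cst.
by under eq_fun do rewrite big_cons; exact: borel_measurableD.
Qed.

Lemma measurable_dot f g :
  measurable_fun [set: T] (f : T -> borel R d) ->
  measurable_fun [set: T] (g : T -> borel R d) ->
  measurable_fun [set: T] (fun t => dot (f t) (g t)).
Proof.
move=> /measurable_coordP mf /measurable_coordP mg.
by apply: measurable_sum => j; exact: measurable_funM.
Qed.

End BorelVectors.

(** * Independence of a fresh seed from the past *)

Section History.
Context {R : realType} {dO : measure_display} {O : measurableType dO}
  {P : probability O R} {I : choiceType} {dS : I -> measure_display}
  {S : forall i, measurableType (dS i)} (X : forall i, {RV P >-> S i}).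

(** The pi-system that generates the sigma-algebra of the variables indexed by [J]. *)
Definition rectangles (J : seq I) : set (set O) :=
  [set B | exists2 A : forall i, set (S i), (forall i, measurable (A i)) &
           B = \bigcap_(i in [set` J]) (X i @^-1` A i)].

(** A copy of [O] with the smaller sigma-algebra, so that dependence on the past alone is ordinary
    measurability. *)
Definition history (J : seq I) := g_sigma_algebraType (rectangles J).

Lemma rectangles_setI J : setI_closed (rectangles J).
Proof.
move=> _ _ [A mA ->] [B mB ->]; exists (fun i => A i `&` B i).
  by move=> i; exact: measurableI.
by rewrite -bigcapI.
Qed.

Lemma rectangles_setT J : rectangles J setT.
Proof.
by exists (fun=> setT) => //; apply/esym/seteqP; split.
Qed.

Lemma measurable_rectangles J : rectangles J `<=` @measurable _ O.
Proof.
move=> _ [A mA ->]; apply: fin_bigcap_measurable; first exact: finite_seq.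
by move=> i _; rewrite -[X in measurable X]setTI; exact: (measurable_funP (X i)).
Qed.

Lemma measurable_history_id J : measurable_fun [set: O] (id : O -> history J).
Proof.
apply: (@measurability _ _ _ (history J) _ _ (rectangles J)) => //.
by move=> _ [B rB <-]; rewrite setTI; exact: (measurable_rectangles rB).
Qed.

Lemma measurable_history_comp J d' (T : measurableType d') (f : history J -> T) :
  measurable_fun [set: history J] f -> measurable_fun [set: O] (f : O -> T).
Proof. by move=> mf; exact: (measurableT_comp mf (@measurable_history_id J)). Qed.

Lemma measurable_history_var J i : i \in J ->
  measurable_fun [set: history J] (X i : history J -> S i).
Proof.
move=> iJ _ A mA; rewrite setTI; apply: sub_sigma_algebra.
(* The rectangle that constrains only the coordinate [i]. *)
exists (dfwith (fun i => [set: S i]) i A).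
  by move=> j; case: dfwithP.
apply/seteqP; split=> [w Aw j _|w /(_ i iJ)].
  by rewrite /preimage /=; case: dfwithP.
by rewrite /preimage /= dfwithin.
Qed.

Hypothesis indepX : mutually_independent X.

(** Mutual independence is applied to [k :: J], with the family of sides updated to [C] at [k]. *)
Lemma rectangles_independent J k B (C : set (S k)) : uniq J -> k \notin J ->
  measurable C -> rectangles J B ->
  P (B `&` X k @^-1` C) = (P B * P (X k @^-1` C))%E.
Proof.
move=> uJ kJ mC [A mA ->].
pose A' := dfwith A k C.
have mA' i : measurable (A' i) by rewrite /A'; case: dfwithP.
have A'J i : i \in J -> A' i = A i.
  by move=> iJ; rewrite /A' dfwithout//; apply: contraNneq kJ => ->.
have <- : \bigcap_(i in [set` k :: J]) (X i @^-1` A' i) =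
    \bigcap_(i in [set` J]) (X i @^-1` A i) `&` X k @^-1` C.
  apply/seteqP; split=> [w hw|w [hw Cw] i].
    split=> [i iJ|]; first by rewrite -A'J//; apply: hw; rewrite /= inE iJ orbT.
    by have := hw k; rewrite /A' dfwithin; apply; rewrite /= inE eqxx.
  rewrite /= inE => /predU1P[->|iJ]; first by rewrite /A' dfwithin.
  by rewrite A'J//; exact: hw.
rewrite (indepX (J := k :: J)) ?(indepX (J := J))//=; last by rewrite kJ.
rewrite big_cons muleC; congr (_ * _)%E; last by rewrite /A' dfwithin.
by apply: eq_big_seq => i iJ; rewrite A'J.
Qed.

(** Uniqueness of measures on a pi-system: [P] restricted to the event that [X k] lies in [C], and
    [P] scaled by the probability of that event, agree on rectangles, hence on the sigma-algebra
    they generate. *)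
Lemma history_independent J k (B : set (history J)) (C : set (S k)) : uniq J ->
  k \notin J -> measurable C -> measurable B ->
  P ((B : set O) `&` X k @^-1` C) = (P B * P (X k @^-1` C))%E.
Proof.
move=> uJ kJ mC mB.
have mXC : measurable (X k @^-1` C).
  by rewrite -[X in measurable X]setTI; exact: (measurable_funP (X k)).
have PCfin : P (X k @^-1` C) \is a fin_num by exact: fin_num_measure.
pose c : {nonneg R} := NngNum (fine_ge0 (measure_ge0 P (X k @^-1` C))).
have cE : (c%:num)%:E = P (X k @^-1` C) by rewrite /= fineK.
have cover : \bigcup_(_ : nat) [set: O] = [set: O] by exact: bigcup_const.
rewrite -cE muleC.
apply: (@g_sigma_algebra_measure_unique _ R O (rectangles J)
  (@measurable_rectangles J) (fun=> setT) (fun=> rectangles_setT J)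
  cover (mrestr P mXC) (mscale c P) (@rectangles_setI J) _ _ B mB).
  move=> D rD; transitivity (P D * P (X k @^-1` C))%E.
    exact: (rectangles_independent uJ kJ mC rD).
  by rewrite -cE muleC.
by move=> _; rewrite /= /mrestr setTI ltey_eq PCfin.
Qed.

(** This takes the place of conditional expectation: by independence the pair formed by the past and
    [X k] has a product law, and Tonelli's theorem integrates the fresh seed first. *)
Lemma integral_fresh J k (law : probability (S k) R)
    (phi : O -> S k -> \bar R) : uniq J -> k \notin J ->
  (forall A, measurable A -> distribution P (X k) A = law A) ->
  measurable_fun [set: history J * S k] (fun p => phi p.1 p.2) ->
  (forall o s, 0 <= phi o s)%E ->
  (\int[P]_o phi o (X k o) = \int[P]_o \int[law]_s phi o s)%E.
Proof.
move=> uJ kJ lawE mphi phi0.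
pose idJ : O -> history J := id.
pose Hmix := isMeasurableFun.Build _ _ _ _ idJ (@measurable_history_id J).
pose H : {mfun O >-> history J} := HB.pack idJ Hmix.
pose m1 := distribution P H.
pose Y (o : O) : history J * S k := (o, X k o).
have mY : measurable_fun [set: O] Y.
  apply: measurable_fun_pair; [exact: measurable_history_id|].
  exact: (measurable_funP (X k)).
pose mYmix := isMeasurableFun.Build _ _ _ _ Y mY.
pose Yf : {mfun O >-> (history J * S k)%type} := HB.pack Y mYmix.
have prodE A : measurable A -> (m1 \x law)%E A = distribution P Yf A.
  apply: product_measure_unique => B C mB mC.
  transitivity (P ((B : set O) `&` X k @^-1` C)); first by [].
  by rewrite history_independent//; congr (_ * _)%E; exact: lawE.
transitivity (\int[distribution P Yf]_z phi z.1 z.2)%E.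
  by rewrite ge0_integral_pushforward.
transitivity (\int[m1 \x law]_z phi z.1 z.2)%E.
  by apply: eq_measure_integral => A mA _; exact/esym/prodE.
rewrite fubini_tonelli1//= /m1 ge0_integral_pushforward//.
  exact: measurable_fun_fubini_tonelli_F.
by move=> o _; exact: integral_ge0.
Qed.

End History.

(** * Quadratic functions of a random vector *)

Lemma probability_integral_cst {R : realType} {d : measure_display}
    {T : measurableType d} (P : probability T R) (r : R) :
  (\int[P]_t r%:E)%E = r%:E.
Proof. by have := expectation_cst P r; rewrite unlock. Qed.

Section Quadratic.
Context {R : realType} {d : nat}.
Implicit Types (q : 'rV[R]_d -> R) (u v w x y : 'rV[R]_d).

(** The second-order part is a multiple of the squared norm, so an expectation depends on the law
    only through its mean and total variance. *)
Definition quadratic (c : R) q :=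
  exists a u, forall y, q y = a + dot u y + c * dot y y.

Lemma quadratic_cst (a : R) : quadratic 0 (fun=> a).
Proof. by exists a, 0 => y; rewrite dot0l mul0r !addr0. Qed.

Lemma quadratic_dot u : quadratic 0 (dot u).
Proof. by exists 0, u => y; rewrite mul0r addr0 add0r. Qed.

Lemma quadratic_sqr : quadratic 1 (fun y => dot y y).
Proof. by exists 0, 0 => y; rewrite dot0l mul1r !add0r. Qed.

Lemma quadraticD c1 c2 q1 q2 : quadratic c1 q1 -> quadratic c2 q2 ->
  quadratic (c1 + c2) (fun y => q1 y + q2 y).
Proof.
move=> [a1 [u1 q1E]] [a2 [u2 q2E]]; exists (a1 + a2), (u1 + u2) => y.
by rewrite q1E q2E dotDl; ring.
Qed.

Lemma quadraticZ c k q : quadratic c q -> quadratic (k * c) (fun y => k * q y).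
Proof.
move=> [a [u qE]]; exists (k * a), (k *: u) => y.
by rewrite qE dotZl; ring.
Qed.

Lemma quadratic_affine c k v q : quadratic c q ->
  quadratic (c * k ^+ 2) (fun y => q (v + k *: y)).
Proof.
move=> [a [u qE]].
exists (a + dot u v + c * dot v v), (k *: u + (2 * c * k) *: v) => y.
by rewrite qE !dotE (dotC y v); ring.
Qed.

Lemma eq_quadratic c c' q q' : c = c' -> q =1 q' ->
  quadratic c q -> quadratic c' q'.
Proof. by move=> -> /funext ->. Qed.

Lemma quadratic_expand c q m : quadratic c q ->
  exists w, forall y, q y = q m + dot w (y - m) + c * dot (y - m) (y - m).
Proof.
move=> [a [u qE]]; exists (u + (2 * c) *: m) => y.
by rewrite !qE !dotE (dotC y m); ring.
Qed.

Context {dS : measure_display} {S : measurableType dS} (law : probability S R)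
  (Y : S -> 'rV[R]_d) (m : 'rV[R]_d) (v : R).
Hypothesis mY : measurable_fun [set: S] (Y : S -> borel R d).
Hypothesis Ymean : forall j, law.-integrable [set: S] (fun s => (Y s 0 j)%:E) /\
  (\int[law]_s (Y s 0 j)%:E)%E = (m 0 j)%:E.

Lemma integral_dot_centered w :
  law.-integrable [set: S] (fun s => (dot w (Y s - m))%:E) /\
  (\int[law]_s (dot w (Y s - m))%:E)%E = 0%E.
Proof.
have iYm j : law.-integrable [set: S] (fun s => ((Y s 0 j) - m 0 j)%:E).
  apply: (@integrableB _ _ _ _ _ measurableT
    (fun s => (Y s 0 j)%:E) (fun=> (m 0 j)%:E)); first by case: (Ymean j).
  exact: finite_measure_integrable_cst.
have iF j : law.-integrable [set: S]
    (fun s => ((w 0 j)%:E * ((Y s 0 j) - m 0 j)%:E)%E).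
  by apply: integrableZl.
have dotE' s : (dot w (Y s - m))%:E =
    (\sum_(j < d) (w 0 j)%:E * ((Y s 0 j) - m 0 j)%:E)%E.
  by rewrite /dot sumEFin; congr EFin; apply: eq_bigr => j _; rewrite !mxE.
split.
  apply: (eq_integrable measurableT _ _ (in1W (fun s => esym (dotE' s)))).
  exact: integrable_sum.
under eq_integral do rewrite dotE'.
rewrite integral_sum// big1// => j _; rewrite integralZl//.
have [iY EY] := Ymean j.
rewrite (_ : \int[law]_s _ = 0)%E ?mule0//.
under eq_integral do rewrite EFinB.
rewrite integralB//; last exact: finite_measure_integrable_cst.
by rewrite EY probability_integral_cst subee.
Qed.

Hypothesis Yvar : (\int[law]_s (dot (Y s - m) (Y s - m))%:E <= v%:E)%E.

(** In the expansion around the mean [m] the linear term integrates to zero, and [c >= 0] preserves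
    the direction of the variance bound. *)
Lemma integral_quadratic_le c q : 0 <= c -> quadratic c q ->
  (\int[law]_s (q (Y s))%:E <= (q m + c * v)%:E)%E.
Proof.
move=> c0 /(@quadratic_expand _ _ m)[w qE].
have [i1 E1] := integral_dot_centered w.
have mV : measurable_fun [set: S] (fun s => dot (Y s - m) (Y s - m)).
  by apply: measurable_dot; apply: borel_measurableB => //;
    exact: borel_measurable_cst.
(* The linear term has no sign, so splitting the integral requires integrability; the finite
   variance bound supplies it for the square. *)
have iV : law.-integrable [set: S] (fun s => (dot (Y s - m) (Y s - m))%:E).
  apply/integrableP; split; first exact/measurable_EFinP.
  apply: le_lt_trans (ltry v); under eq_integral do
    rewrite gee0_abs ?lee_fin ?dot_ge0//.
  exact: Yvar.
have iq : law.-integrable [set: S] (fun=> (q m)%:E).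
  exact: finite_measure_integrable_cst.
under eq_integral do rewrite qE !EFinD EFinM.
rewrite integralD//=; last 2 first.
  exact: integrableD.
  exact: integrableZl.
rewrite integralD// E1 adde0 integralZl// probability_integral_cst.
by rewrite EFinD leeD2l// EFinM lee_wpmul2l// lee_fin.
Qed.

End Quadratic.

(** * Ordering of the seeds *)

Section FreshSeeds.
Context {R : realType} {n d T : nat} {dO : measure_display}
  {O : measurableType dO} {P : probability O R} {M : source n -> stoch_map R d}
  (xi : nat -> forall k : source n, {RV P >-> seed (M k)}).

(** A linear order on the seeds: an iteration occupies [n.*2.+1] consecutive ranks, the gradient
    seed of each worker comes just before its compressor seed, and [C^P] comes last. *)
Definition rank (t : nat) (k : source n) : nat :=
  (t * n.*2.+1 + match k with
                 | inl (inl i) => i.*2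
                 | inl (inr i) => i.*2.+1
                 | inr _ => n.*2
                 end)%N.

(** [source n] is only a [choiceType]; the enumeration is taken over the underlying finite sum
    type. *)
Definition draws_before (N : nat) : seq ('I_T * source n) :=
  seq.filter (fun tk : 'I_T * source n => (rank tk.1 tk.2 < N)%N)
    (enum {: 'I_T * ('I_n + 'I_n + unit)}).

Lemma mem_draws_before N (tk : 'I_T * source n) :
  (tk \in draws_before N) = (rank tk.1 tk.2 < N)%N.
Proof. by rewrite mem_filter mem_enum andbT. Qed.

Lemma draws_before_uniq N : uniq (draws_before N).
Proof. by rewrite filter_uniq// enum_uniq. Qed.

Definition past (N : nat) :=
  history (fun tk : 'I_T * source n => xi tk.1 tk.2) (draws_before N).

Lemma measurable_seed (t : nat) (k : source n) N : (t < T)%N ->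
  (rank t k < N)%N ->
  measurable_fun [set: past N] (xi t k : past N -> seed (M k)).
Proof.
move=> tT rN.
have := @measurable_history_var _ _ _ _ _ _ _
  (fun tk : 'I_T * source n => xi tk.1 tk.2) (draws_before N) (Ordinal tT, k).
by rewrite mem_draws_before => /(_ rN).
Qed.

Definition adapted N (g : O -> 'rV[R]_d) : Prop :=
  measurable_fun [set: past N] (g : past N -> borel R d).

Lemma adapted_measurable N g : adapted N g ->
  measurable_fun [set: O] (g : O -> borel R d).
Proof. exact: measurable_history_comp. Qed.

Lemma measurable_past_comp N (g : O -> R) :
  measurable_fun [set: past N] (g : past N -> R) -> measurable_fun [set: O] g.
Proof. exact: measurable_history_comp. Qed.

Lemma adapted_draw t k N g : (t < T)%N -> (rank t k < N)%N -> adapted N g ->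
  adapted N (fun o => draw (M k) (xi t k o) (g o)).
Proof.
move=> tT rN ag.
exact: (measurableT_comp (@measurable_draw _ _ (M k))
  (measurable_fun_pair (measurable_seed tT rN) ag)).
Qed.

Hypothesis freshxi : fresh_seeds T xi.

(** Averages out one seed: since [N <= rank t k], the seed is independent of [past N], so a bound on
    the integral over the seed with the past frozen passes to the full expectation. *)
Lemma integral_draw_le t k N (g : O -> 'rV[R]_d) (q : O -> 'rV[R]_d -> R)
    (psi : O -> R) :
  (t < T)%N -> (N <= rank t k)%N -> adapted N g ->
  measurable_fun [set: past N * borel R d] (fun p => q p.1 p.2) ->
  (forall o y, 0 <= q o y) ->
  measurable_fun [set: O] psi ->
  (forall o, \int[seed_law (M k)]_s (q o (draw (M k) s (g o)))%:E
             <= (psi o)%:E)%E ->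
  (\int[P]_o (q o (draw (M k) (xi t k o) (g o)))%:E <= \int[P]_o (psi o)%:E)%E.
Proof.
move=> tT rN ag mq q0 mpsi qpsi; have [lawxi indxi] := freshxi.
have kN : (Ordinal tT, k) \notin draws_before N.
  by rewrite mem_draws_before -leqNgt.
pose phi o s := (q o (draw (M k) s (g o)))%:E.
have mphi : measurable_fun [set: past N * seed (M k)] (fun p => phi p.1 p.2).
  apply/measurable_EFinP.
  have mpair : measurable_fun [set: past N * seed (M k)]
      (fun p => (p.1, draw (M k) p.2 (g p.1)) : past N * borel R d).
    apply: measurable_fun_pair; first exact: measurable_fst.
    exact: (measurableT_comp (@measurable_draw _ _ (M k))
      (measurable_fun_pair (@measurable_snd _ _ (past N) (seed (M k)))
        (measurableT_comp ag (@measurable_fst _ _ (past N) (seed (M k)))))).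
  exact: (measurableT_comp mq mpair).
have phi0 o s : (0 <= phi o s)%E by rewrite lee_fin.
rewrite (integral_fresh indxi (draws_before_uniq N) kN (lawxi t k ^~ tT) mphi phi0).
apply: ge0_le_integral => //.
- by move=> o _; exact: integral_ge0.
- have mF := @measurable_fun_fubini_tonelli_F _ _ _ _ _ (seed_law (M k))
    (fun p : past N * seed (M k) => phi p.1 p.2) mphi (fun p => phi0 p.1 p.2).
  exact: (measurable_history_comp mF).
- exact/measurable_EFinP.
- by move=> o _; exact: qpsi.
Qed.

End FreshSeeds.

(** * Lyapunov function *)

(** The scalar core of the drift inequality. [H] and [B] stand for the shift errors of [h] and of
    the gradients at [w], [M2] for the sum of squared mean messages, [W], [X], [gw] for the squared
    norms of w - x, x - xs and grad F w, [p] and [r] for the inner products of grad F w with x - xs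
    and with grad F x, [Fx] and [Fw] for the gaps, [Cq] for the squared distance from the mean next
    model to w, [SE] for the shift error after the mean messages. *)
Lemma drift_arith {R : realType}
    (L mu gamma alpha omega sigma N beta K nu H B M2 W X gw p r Fx Fw Cq SE : R) :
  0 < N -> 0 < L -> 0 < mu -> mu <= L -> 0 <= omega -> 0 < alpha -> alpha <= 1 ->
  0 < gamma -> 100 * gamma * L <= alpha -> gamma * mu * (omega + 1) <= 1 ->
  beta = 1 / (omega + 1) -> K = 8 * gamma * omega * (omega + 1) / N ^+ 2 ->
  nu = 3 * L / alpha ->
  M2 <= 2 * B + 2 * H -> gamma * omega * B <= N ^+ 2 * Fw / 80 ->
  Fw <= 2 * Fx + L * W -> Fx - L * W + mu / 4 * X <= p ->
  (1 - alpha) * Cq <= (1 - alpha / 2) * W + 2 / alpha * gamma ^+ 2 * gw ->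
  gw <= 2 * L * Fw -> - (2 * r) <= L ^+ 2 * W - gw ->
  SE + beta ^+ 2 * omega * M2 = (1 - beta) * H + beta * B ->
  0 <= H -> 0 <= B -> 0 <= W -> 0 <= gw -> 0 <= Fx -> 0 <= Fw ->
  (2 * gamma)^-1 * X - p + gamma / 2 * gw +
  (Fx - gamma * r + L / 2 * gamma ^+ 2 * gw) + K * SE +
  nu * (1 - alpha) * Cq +
  ((gamma / 2 + L / 2 * gamma ^+ 2 + nu * (1 - alpha) * gamma ^+ 2) / N ^+ 2
   + K * beta ^+ 2) * (omega * M2 + N * ((omega + 1) * sigma ^+ 2)) <=
  (1 - gamma * mu / 2) * ((2 * gamma)^-1 * X + Fx + K * H + nu * W) +
  12 * gamma * (omega + 1) * sigma ^+ 2 / N.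
Proof.
move=> N0 L0 mu0 muL omega0 a0 a1 gamma0 gammaL gammamu betaE KE nuE.
move=> M2le Ble Fwle ple cle gle rle SN H0 B0 W0 gw0 Fx0 Fw0.
set e := gamma / 2 + L / 2 * gamma ^+ 2 + nu * (1 - alpha) * gamma ^+ 2.
(* The common unit for the shift errors: [K * beta] is [8 * z], and [e * omega / N ^+ 2] will be at
   most [107 / 200 * z]. *)
set z := gamma * omega / N ^+ 2.
have g0 := ltW gamma0.
have nu0 : 0 <= nu by rewrite nuE divr_ge0 ?mulr_ge0// ltW.
have oge : 1 <= omega + 1 by rewrite lerDr.
have o1 : 0 < omega + 1 by rewrite (lt_le_trans ltr01).
have gL0 : 0 <= gamma * L by rewrite mulr_ge0// ltW.
have gL1 : gamma * L <= 1 / 100 by clear -gammaL a1; lra.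
have nua : nu * alpha = 3 * L by rewrite nuE divfK// gt_eqF.
have bo : beta * (omega + 1) = 1 by rewrite betaE divfK// gt_eqF.
have b0 : 0 < beta by rewrite betaE divr_gt0.
have z0 : 0 <= z by rewrite /z divr_ge0 ?sqr_ge0// mulr_ge0// ltW.
have zN : z * N ^+ 2 = gamma * omega by rewrite /z divfK// gt_eqF// exprn_gt0.
have Kz : K = 8 * z * (omega + 1) by rewrite KE /z; field; rewrite gt_eqF.
have Kb : K * beta = 8 * z by rewrite Kz -mulrA (mulrC _ beta) bo mulr1.
have gmb : gamma * mu <= beta by rewrite betaE ler_pdivlMr.
have b1 : beta <= 1 by rewrite betaE ler_pdivrMr// mul1r.
have nug : nu * gamma <= 3 / 100.
  rewrite -(ler_pM2r L0); have := ler_wpM2l nu0 gammaL; rewrite nua.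
  by clear; lra.
(* The three parts of [e] are at most 1/2, 1/200 and 3/100 times [gamma]. *)
have ele : e <= 107 / 200 * gamma.
  have h1 := ler_wpM2l g0 gL1.
  have h2 := ler_wpM2r g0 nug.
  have h3 := mulr_ge0 (mulr_ge0 nu0 (ltW a0)) (sqr_ge0 gamma).
  rewrite /e; clear -h1 h2 h3; lra.
have e0 : 0 <= e.
  by rewrite /e !addr_ge0// ?mulr_ge0 ?sqr_ge0// ?divr_ge0 ?subr_ge0// ltW.
have t3 : e / N ^+ 2 * (omega * M2) <= 107 / 100 * (z * B + z * H).
  have h1 : e / N ^+ 2 * (omega * M2) <=
      e / N ^+ 2 * (omega * (2 * B + 2 * H)).
    by rewrite ler_wpM2l ?divr_ge0 ?sqr_ge0// ler_wpM2l.
  apply: le_trans h1 _; rewrite -(ler_pM2r (exprn_gt0 2 N0)).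
  have -> : e / N ^+ 2 * (omega * (2 * B + 2 * H)) * N ^+ 2 =
      e * (omega * (2 * B + 2 * H)) by field; rewrite gt_eqF.
  have -> : 107 / 100 * (z * B + z * H) * N ^+ 2 =
      107 / 200 * gamma * (omega * (2 * B + 2 * H)).
    by rewrite /z; field; rewrite gt_eqF.
  by rewrite ler_wpM2r// mulr_ge0// addr_ge0// mulr_ge0.
have t6 : z * B <= Fw / 80.
  rewrite /z mulrAC ler_pdivrMr ?exprn_gt0//.
  by apply: le_trans Ble _; rewrite -mulrA mulrC.
(* The noise coefficient is at most 107/200 + 8, below 12. *)
have t5 : (e / N ^+ 2 + K * beta ^+ 2) * (N * ((omega + 1) * sigma ^+ 2)) <=
    12 * gamma * (omega + 1) * sigma ^+ 2 / N.
  have s0 := sqr_ge0 sigma.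
  have -> : (e / N ^+ 2 + K * beta ^+ 2) * (N * ((omega + 1) * sigma ^+ 2)) =
      (e * (omega + 1) + 8 * gamma * omega) * sigma ^+ 2 / N.
    by rewrite betaE KE; field; rewrite !gt_eqF.
  rewrite ler_pM2r ?invr_gt0// ler_wpM2r//.
  have h1 := ler_wpM2r (ltW o1) ele.
  have h2 : gamma * omega <= gamma * (omega + 1) by rewrite ler_wpM2l// lerDl.
  have h3 : 0 <= gamma * (omega + 1) by rewrite mulr_ge0// ltW.
  by clear -h1 h2 h3; lra.
have gLL : (gamma * L) ^+ 2 <= 1 / 10000.
  have -> : 1 / 10000 = (1 / 100) ^+ 2 :> R by field.
  by rewrite ler_pXn2r// ?nnegrE// divr_ge0.
have gLa : (gamma * L / alpha) ^+ 2 <= 1 / 10000.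
  have -> : 1 / 10000 = (1 / 100) ^+ 2 :> R by field.
  rewrite ler_pXn2r// ?nnegrE ?divr_ge0// ?(ltW a0)// ler_pdivrMr//.
  by clear -gammaL; lra.
have t7 : nu * (1 - alpha) * Cq <= nu * (1 - alpha / 2) * W + 12 / 10000 * Fw.
  rewrite -!mulrA; apply: le_trans (ler_wpM2l nu0 cle) _.
  rewrite mulrDr lerD2l.
  have h1 : 2 / alpha * gamma ^+ 2 * gw <= 2 / alpha * gamma ^+ 2 * (2 * L * Fw).
    by rewrite ler_wpM2l// mulr_ge0 ?sqr_ge0// divr_ge0// ltW.
  apply: le_trans (ler_wpM2l nu0 h1) _.
  have -> : nu * (2 / alpha * gamma ^+ 2 * (2 * L * Fw)) =
      12 * ((gamma * L / alpha) ^+ 2 * Fw) by rewrite nuE; field; rewrite gt_eqF.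
  by have := ler_wpM2r Fw0 gLa; clear; lra.
have t8 : L / 2 * gamma ^+ 2 * gw <= Fw / 10000.
  have h1 : L / 2 * gamma ^+ 2 * gw <= L / 2 * gamma ^+ 2 * (2 * L * Fw).
    by rewrite ler_wpM2l// mulr_ge0 ?sqr_ge0// divr_ge0// ltW.
  by have := ler_wpM2r Fw0 gLL; clear -h1; lra.
have t9 : gamma * mu / 2 * ((2 * gamma)^-1 * X) = mu / 4 * X.
  by field; rewrite gt_eqF.
(* Since [gamma * mu <= beta], half of the decay [K * beta * H] is available, that is
   [4 * z * H]. *)
have t10 : K * (1 - beta) * H + 107 / 100 * (z * H) <=
    (1 - gamma * mu / 2) * (K * H).
  have K0 : 0 <= K.
    by rewrite Kz mulr_ge0 ?(ltW o1)// mulr_ge0.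
  have h1 := ler_wpM2r (mulr_ge0 K0 H0) gmb.
  have h2 : K * beta * H = 8 * (z * H) by rewrite Kb mulrA.
  have h3 := mulr_ge0 z0 H0.
  by clear -h1 h2 h3; lra.
have t11 : Fx / 2 <= (1 - gamma * mu / 2) * Fx.
  have h1 : gamma * mu * Fx <= 1 * Fx by rewrite ler_wpM2r// (le_trans gmb).
  by clear -h1; lra.
(* The choice of [nu] makes [nu * alpha / 2] equal to 3/2 of [L]; the contraction factor costs at
   most 15/1000 of it. *)
have t12 : nu * (1 - alpha / 2) * W + 1485 / 1000 * (L * W) <=
    (1 - gamma * mu / 2) * (nu * W).
  have h1 : nu * alpha * W = 3 * (L * W) by rewrite nua mulrA.
  have h2 : gamma * mu * (nu * W) <= gamma * L * (nu * W).
    by rewrite ler_wpM2r ?mulr_ge0// ler_wpM2l.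
  have h3 := ler_wpM2r (mulr_ge0 (ltW L0) W0) nug.
  by clear -h1 h2 h3; lra.
have t13 : - (gamma * r) <= 1 / 200 * (L * W) - gamma / 2 * gw.
  have h1 := ler_wpM2l g0 rle.
  have h2 := ler_wpM2r (mulr_ge0 (ltW L0) W0) gL1.
  by clear -h1 h2; lra.
have tK : K * SE + K * beta ^+ 2 * (omega * M2) =
    K * (1 - beta) * H + 8 * (z * B).
  rewrite [8 * _]mulrA -Kb -!mulrA -mulrDr -mulrDr; congr (_ * _).
  by rewrite -SN !mulrA.
have LW0 := mulr_ge0 (ltW L0) W0.
(* Final tally: the coefficients of [Fw] sum to less than 1/8, so [Fw <= 2 * Fx + L * W] costs less
   than [Fx / 4] and [L * W / 8]. The reserves are [Fx / 2] from [t11] and 1.485 times [L * W] from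
   [t12], of which [ple] and [t13] take 1.005. *)
clear -t3 t6 t5 t7 t8 t9 t10 t11 t12 t13 tK LW0 Fwle ple Fx0 Fw0.
by lra.
Qed.

(** * The deterministic drift inequality *)

Section Lyapunov.
Context {R : realType} {n d : nat}.
Variables (f : 'I_n -> 'rV[R]_d -> R) (L mu gamma alpha omega sigma : R)
  (Li : 'I_n -> R) (xs : 'rV[R]_d).
Implicit Types (x w v y : 'rV[R]_d) (h m : 'I_n -> 'rV[R]_d).
Local Notation F := (average f).
Local Notation N := (n%:R : R).

Let beta := 1 / (omega + 1).
Let K := 8 * gamma * omega * (omega + 1) / N ^+ 2.
Let nu := 3 * L / alpha.

Definition shift_error h :=
  \sum_i dot (h i - grad (f i) xs) (h i - grad (f i) xs).

Definition lyapunov x w h :=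
  (2 * gamma)^-1 * dot (x - xs) (x - xs) + (F x - F xs)
  + K * shift_error h + nu * dot (w - x) (w - x).

(** The gradient estimator g^t, with the tracked mean shift replaced by the average of the
    shifts. *)
Definition mean_estimate h m := N^-1 *: \sum_i h i + N^-1 *: \sum_i m i.

(* [lyapunov] at the next iterate, given the messages [m], once [f] is replaced
   by its quadratic upper bound at [x] and the mean squared error of [C^P] by
   its bound: a function of [m] that is quadratic in each message. *)
Definition upper_model x w h m :=
  let g := mean_estimate h m in
  (2 * gamma)^-1 * dot (x - gamma *: g - xs) (x - gamma *: g - xs)
  + (F x - F xs - gamma * dot (grad F x) g + L / 2 * gamma ^+ 2 * dot g g)
  + K * shift_error (fun i => h i + beta *: m i)
  + nu * (1 - alpha) * dot (x - gamma *: g - w) (x - gamma *: g - w).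

(** A message enters the estimator with weight [N^-1] and its own shift with weight [beta]; this is
    the resulting coefficient of its squared norm in [upper_model]. *)
Definition message_curvature :=
  (gamma / 2 + L / 2 * gamma ^+ 2 + nu * (1 - alpha) * gamma ^+ 2) / N ^+ 2
  + K * beta ^+ 2.

Hypotheses (n0 : (0 < n)%N) (d0 : (0 < d)%N)
  (fdiff : forall i, differentiable_everywhere (f i))
  (FL : smooth L F) (fL : forall i, smooth (Li i) (f i))
  (fconv : forall i, strongly_convex 0 (f i)) (mu0 : 0 < mu)
  (Fmu : strongly_convex mu F) (Fmin : forall x, F xs <= F x)
  (omega0 : 0 <= omega) (alpha01 : 0 < alpha <= 1) (gamma0 : 0 < gamma)
  (gammaLi : forall i, 160 * gamma * omega * Li i <= N)
  (gammaL : 100 * gamma * L <= alpha)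
  (gammamu : gamma * mu * (omega + 1) <= 1).

Let N0 : 0 < N. Proof. by rewrite ltr0n. Qed.
Let a0 : 0 < alpha. Proof. by case/andP: alpha01. Qed.
Let a1 : alpha <= 1. Proof. by case/andP: alpha01. Qed.
Let L0 : 0 < L.
Proof. exact: (lt_le_trans mu0 (strong_convexity_le_smoothness d0 FL Fmu)). Qed.
Let muL : mu <= L. Proof. exact: strong_convexity_le_smoothness d0 FL Fmu. Qed.
Let K0 : 0 <= K.
Proof.
have h := ltW gamma0.
by rewrite /K divr_ge0 ?sqr_ge0// !mulr_ge0// addr_ge0.
Qed.
Let nu0 : 0 <= nu. Proof. by rewrite /nu divr_ge0 ?mulr_ge0// ltW. Qed.
Let o1 : 0 < omega + 1. Proof. by rewrite ltr_pwDr. Qed.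

Lemma shift_error_ge0 h : 0 <= shift_error h.
Proof. by apply: sumr_ge0 => i _; exact: dot_ge0. Qed.

Lemma lyapunov_ge x w h :
  (2 * gamma)^-1 * dot (x - xs) (x - xs) + (F x - F xs) <= lyapunov x w h.
Proof.
have := mulr_ge0 K0 (shift_error_ge0 h); have := mulr_ge0 nu0 (dot_ge0 (w - x)).
by rewrite /lyapunov; lra.
Qed.

Lemma lyapunov_ge0 x w h : 0 <= lyapunov x w h.
Proof.
apply: le_trans (lyapunov_ge x w h).
by rewrite addr_ge0 ?subr_ge0// mulr_ge0 ?dot_ge0// invr_ge0 mulr_ge0// ltW.
Qed.

Lemma upper_model_bound x w h m :
  let x' := x - gamma *: mean_estimate h m in
  (2 * gamma)^-1 * dot (x' - xs) (x' - xs) + (F x' - F xs)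
  + K * shift_error (fun i => h i + beta *: m i)
  + nu * (1 - alpha) * dot (x' - w) (x' - w) <= upper_model x w h m.
Proof.
set g := mean_estimate h m => /=.
have := smooth_upper_bound x (x - gamma *: g) (ltW L0) FL.
have -> : x - gamma *: g - x = - (gamma *: g) by rewrite addrC addKr.
rewrite /upper_model -/g dotNr dotZr !dotNl dotNr !dotZl dotZr opprK.
lra.
Qed.

Lemma upper_model_ge0 x w h m : 0 <= upper_model x w h m.
Proof.
apply: le_trans (upper_model_bound x w h m) => /=.
have g0 : 0 <= (2 * gamma)^-1 by rewrite invr_ge0 mulr_ge0// ltW.
apply: addr_ge0; last by rewrite mulr_ge0 ?dot_ge0// mulr_ge0// subr_ge0.
apply: addr_ge0; last exact: mulr_ge0 (shift_error_ge0 _).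
by apply: addr_ge0; [exact: mulr_ge0 (dot_ge0 _)|rewrite subr_ge0].
Qed.

Lemma message_curvature_ge0 : 0 <= message_curvature.
Proof.
have e1 : 0 <= nu * (1 - alpha) * gamma ^+ 2.
  by rewrite mulr_ge0 ?sqr_ge0// mulr_ge0// subr_ge0.
have e2 : 0 <= L / 2 * gamma ^+ 2 by rewrite mulr_ge0 ?sqr_ge0// divr_ge0// ltW.
have e3 : 0 <= K * beta ^+ 2 by rewrite mulr_ge0 ?sqr_ge0.
have e4 : 0 <= gamma / 2 by rewrite divr_ge0// ltW.
by rewrite addr_ge0// divr_ge0 ?sqr_ge0// !addr_ge0.
Qed.

Definition with_message m (k : 'I_n) y : 'I_n -> 'rV[R]_d :=
  fun i => if i == k then y else m i.

Lemma mean_estimate_with_message h m k y :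
  mean_estimate h (with_message m k y) =
  mean_estimate h (with_message m k 0) + N^-1 *: y.
Proof.
rewrite /mean_estimate -[RHS]addrA -[in RHS]scalerDr; congr (_ + _ *: _).
rewrite (bigD1 k)//= [in RHS](bigD1 k)//= /with_message eqxx add0r addrC; congr (_ + _).
by apply: eq_bigr => i /negPf ->.
Qed.

(** Each summand of [upper_model] is constant, linear or a squared norm, composed with an affine map
    of the [k]-th message; [S0] collects the shift errors of the other workers. *)
Lemma quadratic_upper_model x w h m k :
  quadratic message_curvature (fun y => upper_model x w h (with_message m k y)).
Proof.
set v := mean_estimate h (with_message m k 0).
pose S0 := \sum_(i | i != k)
  dot (h i + beta *: m i - grad (f i) xs) (h i + beta *: m i - grad (f i) xs).
have qsqr b u : quadratic (b ^+ 2) (fun y => dot (u + b *: y) (u + b *: y)).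
  by have := quadratic_affine b u (@quadratic_sqr R d); rewrite mul1r.
have qdot b u u' : quadratic 0 (fun y => dot u' (u + b *: y)).
  by have := quadratic_affine b u (quadratic_dot u'); rewrite mul0r.
have q1 := quadraticZ (2 * gamma)^-1 (qsqr (- gamma / N) (x - gamma *: v - xs)).
have q2 := quadraticZ (- gamma) (qdot N^-1 v (grad F x)).
have q3 := quadraticZ (L / 2 * gamma ^+ 2) (qsqr N^-1 v).
have q4 := quadraticZ K (qsqr beta (h k - grad (f k) xs)).
have q5 := quadraticZ (nu * (1 - alpha))
  (qsqr (- gamma / N) (x - gamma *: v - w)).
have q := quadraticD (quadraticD (quadraticD (quadraticD (quadraticD
  (quadratic_cst (F x - F xs + K * S0)) q1) q2) q3) q4) q5.
apply: eq_quadratic q => [|y].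
  rewrite /message_curvature; move: K nu beta => k' nu' b'.
  by field; rewrite !gt_eqF.
rewrite /upper_model mean_estimate_with_message -/v.
have E u : x - gamma *: (v + N^-1 *: y) - u =
    x - gamma *: v - u + (- gamma / N) *: y.
  by rewrite scalerDr scalerA opprD addrA [LHS]addrAC mulNr scaleNr.
rewrite !E /shift_error (bigD1 k)//= {1 2}/with_message eqxx.
rewrite (addrAC (h k)) (eq_bigr (fun i => dot (h i + beta *: m i - grad (f i) xs)
  (h i + beta *: m i - grad (f i) xs))); last first.
  by move=> i /negPf ik; rewrite /with_message ik.
by rewrite -/S0; ring.
Qed.

(** An exact identity because [beta ^+ 2 * (1 + omega) = beta]: the compressor variance completes
    the square of a convex combination. *)
Lemma shift_error_next h w :
  shift_error (fun i => h i + beta *: (grad (f i) w - h i))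
  + beta ^+ 2 * omega * \sum_i dot (grad (f i) w - h i) (grad (f i) w - h i) =
  (1 - beta) * shift_error h
  + beta * shift_error (fun i => grad (f i) w).
Proof.
rewrite /shift_error !mulr_sumr -!big_split; apply: eq_bigr => i _ /=.
set a := h i - grad (f i) xs; set b := grad (f i) w - grad (f i) xs.
have -> : grad (f i) w - h i = b - a by rewrite /a /b opprB addrA subrK.
have -> : h i + beta *: (b - a) - grad (f i) xs = a + beta *: (b - a).
  by rewrite addrAC.
clearbody a b; rewrite !dotE (dotC b a) /beta; field.
by rewrite gt_eqF.
Qed.

Lemma dot_sqrD_le (u v : 'rV[R]_d) :
  dot (u + v) (u + v) <= 2 * dot u u + 2 * dot v v.
Proof. by have := dot_ge0 (u - v); rewrite !dotE (dotC v u); lra. Qed.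

Lemma sum_message_le h w :
  \sum_i dot (grad (f i) w - h i) (grad (f i) w - h i) <=
  2 * shift_error (fun i => grad (f i) w) + 2 * shift_error h.
Proof.
rewrite /shift_error !mulr_sumr -!big_split; apply: ler_sum => i _ /=.
have := dot_sqrD_le (grad (f i) w - grad (f i) xs) (grad (f i) xs - h i).
rewrite addrA subrK => /le_trans; apply; rewrite lerD2l.
by rewrite -opprB dotNl dotNr opprK.
Qed.

(** Cocoercivity bounds each summand by [2 * Li i] times the Bregman divergence [D i], and the step
    size turns 160 into 80. The divergences add up to the gap of the average because the gradients
    at [xs] sum to zero. *)
Lemma grad_error_le w :
  gamma * omega * shift_error (fun i => grad (f i) w) <=
  N ^+ 2 * (F w - F xs) / 80.
Proof.
have gF : \sum_i grad (f i) xs = 0.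
  have := grad_minimizer L0 FL Fmin; rewrite grad_average// => /eqP.
  by rewrite scaler_eq0 invr_eq0 gt_eqF//= => /eqP.
pose D i := f i w - f i xs - dot (grad (f i) xs) (w - xs).
have D0 i : 0 <= D i.
  have := strongly_convex_lower_bound xs w (fdiff i) (fconv i).
  by rewrite mul0r mul0r addr0 /D; lra.
have sD : \sum_i D i = N * (F w - F xs).
  rewrite /D !sumrB -dot_suml gF dot0l subr0 /average -mulrBr mulrA divff ?mul1r//.
  by rewrite gt_eqF.
rewrite (_ : N ^+ 2 * (F w - F xs) / 80 = \sum_i N * D i / 80); last first.
  by rewrite -mulr_suml -mulr_sumr sD mulrA -expr2.
rewrite /shift_error mulr_sumr; apply: ler_sum => i _.
have Li0 := smooth_ge0 d0 (fL i).
have := cocoercive w xs Li0 (fL i) (fconv i); rewrite -/(D i) => cD.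
have go : 0 <= gamma * omega by rewrite mulr_ge0// ltW.
apply: le_trans (ler_wpM2l go cD) _.
have := ler_wpM2r (D0 i) (gammaLi i); lra.
Qed.

(** The descent lemma at [x], with the linear term split by Young's inequality of weight [L^-1] and
    the squared gradient bounded by the gap at [x]. *)
Lemma gap_shift_le x w :
  F w - F xs <= 2 * (F x - F xs) + L * dot (w - x) (w - x).
Proof.
have up := smooth_upper_bound x w (ltW L0) FL.
have := @dot_le_sqr _ _ L^-1 (grad F x) (w - x); rewrite invr_gt0 invrK => /(_ L0).
have := grad_sqr_le x L0 FL Fmin => gx.
have : L^-1 * dot (grad F x) (grad F x) <= 2 * (F x - F xs).
  by rewrite ler_pdivrMl// mulrA (mulrC L).
lra.
Qed.

(** Smoothness bounds F x from above and strong convexity bounds F xs from below, both from [w].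
    Moving the strong convexity term from xs - w to x - xs halves it and costs [mu / 2] times the
    squared shift, absorbed by [mu <= L]. *)
Lemma inner_grad_ge x w :
  (F x - F xs) - L * dot (w - x) (w - x) + mu / 4 * dot (x - xs) (x - xs) <=
  dot (grad F w) (x - xs).
Proof.
have up := smooth_upper_bound w x (ltW L0) FL.
have lo := strongly_convex_lower_bound w xs FL.1 Fmu.
have xE : x - xs = (x - w) - (xs - w) by rewrite opprB addrA subrK.
have W : dot (x - w) (x - w) = dot (w - x) (w - x).
  by rewrite -opprB dotNl dotNr opprK.
have := dot_sqrD_le (x - w) (- (xs - w)).
rewrite -xE !(dotNl, dotNr) opprK W => X.
have -> : dot (grad F w) (x - xs) =
    dot (grad F w) (x - w) - dot (grad F w) (xs - w).
  by rewrite -dotNr -dotDr -xE.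
move: up; rewrite W => up.
have mX := ler_wpM2l (ltW mu0) X.
have mW := ler_wpM2r (dot_ge0 (w - x)) muL.
lra.
Qed.

(** Young's inequality with weight [alpha / 2], followed by (1 - alpha)(1 + alpha/2) <= 1 - alpha/2
    and (1 - alpha)(1 + 2/alpha) <= 2/alpha. *)
Lemma contraction_le x w :
  (1 - alpha) * dot (x - gamma *: grad F w - w) (x - gamma *: grad F w - w) <=
  (1 - alpha / 2) * dot (w - x) (w - x)
  + 2 / alpha * gamma ^+ 2 * dot (grad F w) (grad F w).
Proof.
set g := gamma *: grad F w; pose u := x - w.
have -> : x - g - w = u - g by rewrite addrAC.
have -> : dot (w - x) (w - x) = dot u u.
  by rewrite -opprB dotNl dotNr opprK.
have -> : 2 / alpha * gamma ^+ 2 * dot (grad F w) (grad F w) =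
    2 / alpha * dot g g by rewrite dotZl dotZr; ring.
clearbody u g.
have := @dot_le_sqr _ _ (alpha / 2) u (- g); rewrite divr_gt0// => /(_ isT).
rewrite !dotE !(mulrN, mulNr, opprK) invf_div (dotC g u) => h.
have u0 := dot_ge0 u; have g0 := dot_ge0 g.
have := ler_wpM2l (_ : 0 <= 1 - alpha) h; rewrite subr_ge0 => /(_ a1) h'.
have e : 2 / alpha * alpha = 2 by rewrite divfK// gt_eqF.
move: h' e u0 g0; move: (2 / alpha) => c.
move: (dot u u) (dot u g) (dot g g) => U UG GG h' e U0 G0.
have e1 : c * alpha * GG = 2 * GG by rewrite e.
have e2 : 0 <= alpha ^+ 2 * U by rewrite mulr_ge0// sqr_ge0.
have e3 : 0 <= alpha * GG by rewrite mulr_ge0// ltW.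
by lra.
Qed.

Lemma mean_estimate_unbiased h w :
  mean_estimate h (fun i => grad (f i) w - h i) = grad F w.
Proof.
rewrite grad_average// /mean_estimate -scalerDr -big_split; congr (_ *: _).
by apply: eq_bigr => i _ /=; rewrite addrC subrK.
Qed.

Lemma expected_upper_model_le x w h :
  upper_model x w h (fun i => grad (f i) w - h i)
  + \sum_i message_curvature *
      (omega * dot (grad (f i) w - h i) (grad (f i) w - h i)
       + (omega + 1) * sigma ^+ 2) <=
  (1 - gamma * mu / 2) * lyapunov x w h
  + 12 * gamma * (omega + 1) * sigma ^+ 2 / N.
Proof.
rewrite -mulr_sumr big_split /= -mulr_sumr sumr_const card_ord -[_ *+ n]mulr_natl.
rewrite /upper_model mean_estimate_unbiased /lyapunov.
have SN := shift_error_next h w.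
set SE := shift_error (fun i => h i + _) in SN *.
have M2le := sum_message_le h w; have Ble := grad_error_le w.
have Fwle := gap_shift_le x w; have ple := inner_grad_ge x w.
have cle := contraction_le x w; have gle := grad_sqr_le w L0 FL Fmin.
(* The Lipschitz bound on the gradient difference is expanded and the square of [grad F x]
   dropped. *)
have rle : - (2 * dot (grad F x) (grad F w)) <=
    L ^+ 2 * dot (w - x) (w - x) - dot (grad F w) (grad F w).
  have := enorm_sqrM (FL.2 w x).
  have := dot_ge0 (grad F x); rewrite !dotE (dotC (grad F w) (grad F x)); lra.
have -> : (2 * gamma)^-1 *
    dot (x - gamma *: grad F w - xs) (x - gamma *: grad F w - xs) =
    (2 * gamma)^-1 * dot (x - xs) (x - xs) - dot (grad F w) (x - xs)
    + gamma / 2 * dot (grad F w) (grad F w).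
  rewrite (addrAC x) ![dot (x - xs - _) _]dotDl dotNl dotZl.
  rewrite !(dotDr (x - xs) (x - xs)) !(dotDr (grad F w) (x - xs)) !dotNr !dotZr.
  rewrite (dotC (x - xs) (grad F w)); field.
  by rewrite gt_eqF.
have H0 := shift_error_ge0 h.
have B0 := shift_error_ge0 (fun i => grad (f i) w).
have W0 := dot_ge0 (w - x); have X0 := dot_ge0 (x - xs).
have gw0 := dot_ge0 (grad F w).
have Fx0 : 0 <= F x - F xs by rewrite subr_ge0.
have Fw0 : 0 <= F w - F xs by rewrite subr_ge0.
rewrite /message_curvature.
move: SE M2le Ble Fwle ple cle gle rle SN H0 B0 W0 X0 gw0 Fx0 Fw0.
move: (shift_error h) (shift_error _) (\sum_i _) (dot (w - x) (w - x))
  (dot (x - xs) (x - xs)) (dot (grad F w) (grad F w)) (dot (grad F w) (x - xs))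
  (dot (grad F x) (grad F w)) (F x - F xs) (F w - F xs) (dot (_ - w) _)
  => H B M2 W X gw p r Fx Fw Cq SE.
move=> M2le Ble Fwle ple cle gle rle SN H0 B0 W0 X0 gw0 Fx0 Fw0.
have := drift_arith sigma N0 L0 mu0 muL omega0 a0 a1 gamma0 gammaL gammamu erefl
  erefl erefl M2le Ble Fwle ple cle gle rle SN H0 B0 W0 gw0 Fx0 Fw0.
exact.
Qed.

End Lyapunov.

(** * Measurability of the Lyapunov function and of its upper model *)

Section LyapunovMeasurability.
Context {R : realType} {n d : nat}.

Lemma measurable_differentiable (g : 'rV[R]_d -> R) :
  differentiable_everywhere g ->
  measurable_fun [set: borel R d] (g : borel R d -> R).
Proof.
move=> dg; apply: measurable_continuous_borel => x.
exact: (differentiable_continuous (dg x)).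
Qed.

Lemma measurable_grad (L : R) (g : 'rV[R]_d -> R) : smooth L g ->
  measurable_fun [set: borel R d] (grad g : borel R d -> borel R d).
Proof.
move=> [_ Lg]; apply/measurable_coordP => j.
apply: measurable_continuous_borel => x.
apply/(@cvgrPdist_lt _ _ _ _ (nbhs_filter x)) => e e0.
pose c := L ^+ 2 * d%:R; have c0 : 0 <= c by rewrite mulr_ge0 ?sqr_ge0.
have c1 : 0 < c + 1 by rewrite ltr_pwDr.
(* Balls are for the sup norm, so radius [r] bounds the squared gradient increment by [c * r ^+ 2],
   which is below [e ^+ 2] as [c < (c + 1) ^+ 2]. *)
pose r := e / (c + 1); have r0 : 0 < r by rewrite divr_gt0.
have re : e = r * (c + 1) by rewrite /r divfK// gt_eqF.
apply/nbhs_ballP; exists r => //= y [_ xy].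
have dxy : dot (x - y) (x - y) <= d%:R * r ^+ 2.
  rewrite /dot (le_trans (ler_sum _ (G := fun=> r ^+ 2) _))//.
    move=> i _; have := xy 0 i; rewrite /ball /= !mxE -expr2 => xyi.
    by rewrite -real_normK ?num_real// ler_pXn2r ?nnegrE ?normr_ge0 ?ltW.
  by rewrite sumr_const card_ord mulr_natl.
have := enorm_sqrM (Lg x y) => gxy.
have := dot_coord_le (grad g x - grad g y) j; rewrite !mxE => gj.
rewrite -(@ltr_pXn2r _ 2)// ?nnegrE ?normr_ge0 ?ltW// real_normK ?num_real//.
apply: le_lt_trans gj _; apply: le_lt_trans gxy _.
apply: le_lt_trans (ler_wpM2l (sqr_ge0 L) dxy) _.
rewrite mulrA -/c re; have := exprn_gt0 2 r0; clearbody c r => r20.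
rewrite exprMn mulrC ltr_pM2l//; nra.
Qed.

Lemma measurable_shift_error (f : 'I_n -> 'rV[R]_d -> R) (xs : 'rV[R]_d) dT
    (T : measurableType dT) (h : 'I_n -> T -> 'rV[R]_d) :
  (forall i, measurable_fun [set: T] (h i : T -> borel R d)) ->
  measurable_fun [set: T] (fun t => shift_error f xs (h ^~ t)).
Proof.
move=> mh; apply: measurable_sum => i.
by apply: measurable_dot; apply: borel_measurableB => //;
  exact: borel_measurable_cst.
Qed.

Context (f : 'I_n -> 'rV[R]_d -> R) (L gamma alpha omega : R) (Li : 'I_n -> R)
  (xs : 'rV[R]_d).
Hypotheses (FL : smooth L (average f)) (fL : forall i, smooth (Li i) (f i)).
Context dT (T : measurableType dT) (x w : T -> 'rV[R]_d)
  (h m : 'I_n -> T -> 'rV[R]_d).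
Hypotheses (mx : measurable_fun [set: T] (x : T -> borel R d))
  (mw : measurable_fun [set: T] (w : T -> borel R d))
  (mh : forall i, measurable_fun [set: T] (h i : T -> borel R d))
  (mm : forall i, measurable_fun [set: T] (m i : T -> borel R d)).

Lemma measurable_mean_estimate :
  measurable_fun [set: T] (fun t => mean_estimate (h ^~ t) (m ^~ t) : borel R d).
Proof.
by apply: borel_measurableD; apply: borel_measurableZ;
  exact: borel_measurable_sum.
Qed.

Lemma measurable_lyapunov : measurable_fun [set: T]
  (fun t => lyapunov f L gamma alpha omega xs (x t) (w t) (h ^~ t)).
Proof.
apply: measurable_funD; last first.
  by apply: measurable_funM => //; apply: measurable_dot; exact: borel_measurableB.
apply: measurable_funD; last first.
  by apply: measurable_funM => //; exact: measurable_shift_error.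
apply: measurable_funD.
  by apply: measurable_funM => //; apply: measurable_dot;
    apply: borel_measurableB => //; exact: borel_measurable_cst.
apply: measurable_funB => //.
exact: (measurableT_comp (measurable_differentiable FL.1) mx).
Qed.

Lemma measurable_upper_model : measurable_fun [set: T]
  (fun t => upper_model f L gamma alpha omega xs (x t) (w t) (h ^~ t) (m ^~ t)).
Proof.
have mg := measurable_mean_estimate.
have mx' (u : T -> 'rV[R]_d) : measurable_fun [set: T] (u : T -> borel R d) ->
    measurable_fun [set: T] (fun t =>
      x t - gamma *: mean_estimate (h ^~ t) (m ^~ t) - u t : borel R d).
  move=> mu; apply: borel_measurableB => //; apply: borel_measurableB => //.
  exact: borel_measurableZ.
apply: measurable_funD; last first.
  by apply: measurable_funM => //; apply: measurable_dot; exact: mx'.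
apply: measurable_funD; last first.
  apply: measurable_funM => //.
  apply: (@measurable_shift_error f xs _ _
    (fun i t => h i t + (1 / (omega + 1)) *: m i t)) => i.
  by apply: borel_measurableD => //; exact: borel_measurableZ.
apply: measurable_funD.
  by apply: measurable_funM => //; apply: measurable_dot; apply: mx';
    exact: borel_measurable_cst.
apply: measurable_funD; last first.
  by apply: measurable_funM => //; exact: measurable_dot.
apply: measurable_funB.
  apply: measurable_funB => //.
  exact: (measurableT_comp (measurable_differentiable FL.1) mx).
apply: measurable_funM => //; apply: measurable_dot => //.
exact: (measurableT_comp (measurable_grad FL) mx).
Qed.

End LyapunovMeasurability.

(** * Expectation over one iteration *)

Lemma measurable_sum_cond {R : realType} {d : measure_display}
    {T : measurableType d} {I : Type} (r : seq I) (Q : pred I)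
    (F : I -> T -> R) :
  (forall i, measurable_fun [set: T] (F i)) ->
  measurable_fun [set: T] (fun t => \sum_(i <- r | Q i) F i t).
Proof.
move=> mF; under eq_fun do rewrite big_mkcond /=.
by apply: measurable_sum => i; case: (Q i).
Qed.

Section OneIteration.
Context {R : realType} {n d T : nat} {dO : measure_display}
  {O : measurableType dO} {P : probability O R}.
Context (f : 'I_n -> 'rV[R]_d -> R) (L mu gamma alpha omega sigma : R)
  (Li : 'I_n -> R) (xs : 'rV[R]_d) (G CD : 'I_n -> stoch_map R d)
  (CP : stoch_map R d)
  (xi : nat -> forall k : source n, {RV P >-> seed (source_map G CD CP k)}).
Hypotheses (n0 : (0 < n)%N) (d0 : (0 < d)%N)
  (fdiff : forall i, differentiable_everywhere (f i))
  (FL : smooth L (average f)) (fL : forall i, smooth (Li i) (f i))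
  (fconv : forall i, strongly_convex 0 (f i)) (mu0 : 0 < mu)
  (Fmu : strongly_convex mu (average f))
  (Fmin : forall x, average f xs <= average f x)
  (omega0 : 0 <= omega) (alpha01 : 0 < alpha <= 1) (gamma0 : 0 < gamma)
  (gammaLi : forall i, 160 * gamma * omega * Li i <= n%:R)
  (gammaL : 100 * gamma * L <= alpha)
  (gammamu : gamma * mu * (omega + 1) <= 1)
  (Gmean : forall i, unbiased (G i) (grad (f i)))
  (Gvar : forall i x, (mean_sq_error (G i) (grad (f i)) x <= (sigma ^+ 2)%:E)%E)
  (CDomega : forall i, unbiased_compressor omega (CD i))
  (CPalpha : contractive alpha CP) (freshxi : fresh_seeds T xi).

Local Notation up := (upper_model f L gamma alpha omega xs).
Local Notation ly := (lyapunov f L gamma alpha omega xs).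
Local Notation cv := (@message_curvature R n L gamma alpha omega).

Let cv0 : 0 <= cv := message_curvature_ge0 d0 FL mu0 Fmu omega0 alpha01 gamma0.
Let up0 x w h m : 0 <= up x w h m :=
  upper_model_ge0 d0 FL mu0 Fmu Fmin omega0 alpha01 gamma0 x w h m.
Let ly0 x w h : 0 <= ly x w h :=
  lyapunov_ge0 d0 FL mu0 Fmu Fmin omega0 alpha01 gamma0 x w h.

Lemma measurable_draw_at (C : stoch_map R d) y :
  measurable_fun [set: seed C] (draw C ^~ y : seed C -> borel R d).
Proof.
exact: (measurableT_comp (@measurable_draw _ _ C)
  (@pair2_measurable _ _ (seed C) (borel R d) y)).
Qed.

Lemma integral_mean_sq_error (C : stoch_map R d) (F : 'rV[R]_d -> 'rV[R]_d) y :
  (\int[seed_law C]_s (dot (draw C s y - F y) (draw C s y - F y))%:E)%E =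
  mean_sq_error C F y.
Proof.
rewrite /mean_sq_error unlock; apply: eq_integral => s _.
by rewrite enorm_sqr.
Qed.

Lemma integral_draw_quadratic_le (C : stoch_map R d) (F : 'rV[R]_d -> 'rV[R]_d)
    y (v c : R) q : unbiased C F -> (mean_sq_error C F y <= v%:E)%E ->
  0 <= c -> quadratic c q ->
  (\int[seed_law C]_s (q (draw C s y))%:E <= (q (F y) + c * v)%:E)%E.
Proof.
move=> CF Cv c0 qc; apply: integral_quadratic_le => //.
- exact: measurable_draw_at.
- by move=> j; have [iC EC] := CF y j; split=> //; rewrite -EC unlock.
- by rewrite integral_mean_sq_error.
Qed.

Context (t : nat) (tT : (t < T)%N) (x w : O -> 'rV[R]_d)
  (h : 'I_n -> O -> 'rV[R]_d).
(** The number of seeds drawn in the first [t] iterations. Adaptedness is assumed at every later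
    stage because each seed is integrated against its own past. *)
Let N0 := (t * n.*2.+1)%N.
Hypotheses (ax : forall N, (N0 <= N)%N -> adapted (T := T) xi N x)
  (aw : forall N, (N0 <= N)%N -> adapted (T := T) xi N w)
  (ah : forall N i, (N0 <= N)%N -> adapted (T := T) xi N (h i)).

Definition gradient i o := draw (G i) (xi t (inl (inl i)) o) (w o).

Definition message i o :=
  draw (CD i) (xi t (inl (inr i)) o) (gradient i o - h i o).

Definition residual i o := grad (f i) (w o) - h i o.

(* The messages of the first [k] workers are kept, the others are replaced by
   their conditional means. *)
Definition partial_messages k (i : 'I_n) o :=
  if (i < k)%N then message i o else residual i o.

(** The price of replacing one message by its mean: the stochastic gradient contributes variance
    [sigma ^+ 2] directly, and [omega] times as much again through the compressor. *)
Definition message_noise i o :=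
  cv * (omega * dot (residual i o) (residual i o) + (omega + 1) * sigma ^+ 2).

(** Interpolates between the actual messages without added noise at [k = n] and the mean messages
    with all the noise at [k = 0]. *)
Definition partial_model k o :=
  up (x o) (w o) (h ^~ o) (partial_messages k ^~ o)
  + \sum_(i < n | (k <= i)%N) message_noise i o.

Lemma adapted_gradient N (i : 'I_n) : (N0 + i.*2 < N)%N ->
  adapted (T := T) xi N (gradient i).
Proof.
move=> iN; apply: (@adapted_draw _ _ _ _ _ _ _ (source_map G CD CP) xi t
  (inl (inl i))) => //.
by apply: aw; apply: leq_trans (ltnW iN); rewrite leq_addr.
Qed.

Lemma adapted_message N (i : 'I_n) : (N0 + i.*2.+1 < N)%N ->
  adapted (T := T) xi N (message i).
Proof.
move=> iN; apply: (@adapted_draw _ _ _ _ _ _ _ (source_map G CD CP) xi t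
  (inl (inr i))) => //.
apply: borel_measurableB.
  by apply: adapted_gradient; apply: leq_trans iN; rewrite ltnS leq_add2l.
by apply: ah; apply: leq_trans (ltnW iN); rewrite leq_addr.
Qed.

Lemma adapted_residual N i : (N0 <= N)%N -> adapted (T := T) xi N (residual i).
Proof.
move=> N0N; apply: borel_measurableB; last exact: ah.
exact: (measurableT_comp (measurable_grad (fL i)) (aw N0N)).
Qed.

Lemma adapted_partial_messages N k (i : 'I_n) : (N0 + k.*2 <= N)%N ->
  adapted (T := T) xi N (partial_messages k i).
Proof.
move=> kN; rewrite /partial_messages; case: ltnP => ik.
  apply: adapted_message; apply: leq_trans kN.
  by rewrite -addnS leq_add2l -doubleS leq_double.
by apply: adapted_residual; apply: leq_trans kN; rewrite leq_addr.
Qed.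

Lemma message_noise_ge0 i o : 0 <= message_noise i o.
Proof.
by rewrite mulr_ge0// addr_ge0// mulr_ge0 ?dot_ge0 ?sqr_ge0// addr_ge0.
Qed.

Lemma measurable_message_noise N i : (N0 <= N)%N ->
  measurable_fun [set: past (T := T) xi N]
    (message_noise i : past (T := T) xi N -> R).
Proof.
move=> N0N; apply: measurable_funM => //; apply: measurable_funD => //.
by apply: measurable_funM => //; apply: measurable_dot; exact: adapted_residual.
Qed.

Lemma partial_model_ge0 k o : 0 <= partial_model k o.
Proof.
by rewrite addr_ge0//; apply: sumr_ge0 => i _; exact: message_noise_ge0.
Qed.

Lemma measurable_partial_model k : measurable_fun [set: O] (partial_model k).
Proof.
pose N := (N0 + k.*2)%N; have N0N : (N0 <= N)%N by rewrite leq_addr.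
apply: (measurable_past_comp (T := T) (xi := xi) (N := N)).
apply: measurable_funD.
  apply: measurable_upper_model => //; [exact: ax|exact: aw|move=> i; exact: ah|].
  by move=> i; exact: adapted_partial_messages.
by apply: measurable_sum_cond => i; exact: measurable_message_noise.
Qed.

Lemma partial_messages_next (k : 'I_n) o :
  partial_messages k.+1 ^~ o = with_message (partial_messages k ^~ o) k (message k o).
Proof.
apply/funext => i; rewrite /partial_messages /with_message ltnS leq_eqVlt.
by have [->|ik] := eqVneq i k; rewrite ?eqxx//= val_eqE (negPf ik).
Qed.

Lemma partial_messages_residual (k : 'I_n) o :
  with_message (partial_messages k ^~ o) k (residual k o) = partial_messages k ^~ o.
Proof.
apply/funext => i; rewrite /partial_messages /with_message.
by have [->|//] := eqVneq i k; rewrite ltnn.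
Qed.

Definition remaining_noise k o := \sum_(i < n | (k <= i)%N) message_noise i o.

Lemma remaining_noise_next (k : 'I_n) o :
  remaining_noise k o = message_noise k o + remaining_noise k.+1 o.
Proof.
rewrite /remaining_noise (bigD1 k)//=; congr (_ + _); apply: eq_bigl => i.
by rewrite ltn_neqAle andbC eq_sym.
Qed.

Lemma remaining_noise_ge0 k o : 0 <= remaining_noise k o.
Proof. by apply: sumr_ge0 => i _; exact: message_noise_ge0. Qed.

(* The partial model as a function of the [k]-th message, and then of the
   [k]-th stochastic gradient once the compressor has been averaged out. *)
Definition message_model (k : 'I_n) o y :=
  up (x o) (w o) (h ^~ o) (with_message (partial_messages k ^~ o) k y)
  + remaining_noise k.+1 o.

Definition gradient_model (k : 'I_n) o y :=
  message_model k o (y - h k o)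
  + cv * (omega * dot (y - h k o) (y - h k o)).

Lemma message_model_ge0 k o y : 0 <= message_model k o y.
Proof. by rewrite addr_ge0// remaining_noise_ge0. Qed.

Lemma gradient_model_ge0 k o y : 0 <= gradient_model k o y.
Proof.
by rewrite addr_ge0 ?message_model_ge0// mulr_ge0// mulr_ge0 ?dot_ge0.
Qed.

Lemma quadratic_message_model k o : quadratic cv (message_model k o).
Proof.
have := quadraticD (quadratic_upper_model f L alpha omega xs n0 gamma0
  (x o) (w o) (h ^~ o) (partial_messages k ^~ o) k)
  (quadratic_cst (remaining_noise k.+1 o)).
by apply: eq_quadratic; rewrite ?addr0.
Qed.

Lemma quadratic_gradient_model k o :
  quadratic (cv * (omega + 1)) (gradient_model k o).
Proof.
have q1 := quadratic_affine 1 (- h k o) (quadratic_message_model k o).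
have q2 := quadratic_affine 1 (- h k o) (quadraticZ (cv * omega) (@quadratic_sqr R d)).
apply: eq_quadratic (quadraticD q1 q2) => [|y]; first by ring.
by rewrite /gradient_model scale1r [- h k o + y]addrC mulrA.
Qed.

Local Notation past := (past (T := T) xi).

Lemma measurable_message_model N (k : 'I_n) : (N0 + k.*2 <= N)%N ->
  measurable_fun [set: past N * borel R d] (fun p => message_model k p.1 p.2).
Proof.
move=> kN; have N0N : (N0 <= N)%N by apply: leq_trans kN; rewrite leq_addr.
have mfst (u : O -> 'rV[R]_d) : adapted (T := T) xi N u ->
    measurable_fun [set: past N * borel R d] (fun p => u p.1 : borel R d).
  by move=> au; exact: (measurableT_comp au (@measurable_fst _ _ (past N) (borel R d))).
apply: measurable_funD; last first.
  apply: measurable_sum_cond => i.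
  exact: (measurableT_comp (measurable_message_noise i N0N)
    (@measurable_fst _ _ (past N) (borel R d))).
have := @measurable_upper_model R n d f L gamma alpha omega xs FL _
  (past N * borel R d)%type (fun p => x p.1) (fun p => w p.1)
  (fun i p => h i p.1)
  (fun i p => if i == k then p.2 else partial_messages k i p.1).
apply; [exact: mfst (ax N0N)|exact: mfst (aw N0N)|by move=> i; exact: mfst (ah i N0N)|move=> i].
case: eqP => _; first exact: measurable_snd.
by apply: mfst; exact: adapted_partial_messages.
Qed.

Lemma measurable_gradient_model N (k : 'I_n) : (N0 + k.*2 <= N)%N ->
  measurable_fun [set: past N * borel R d] (fun p => gradient_model k p.1 p.2).
Proof.
move=> kN; have N0N : (N0 <= N)%N by apply: leq_trans kN; rewrite leq_addr.
have mh : measurable_fun [set: past N * borel R d]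
    (fun p => p.2 - h k p.1 : borel R d).
  apply: borel_measurableB; first exact: measurable_snd.
  exact: (measurableT_comp (ah k N0N) (@measurable_fst _ _ (past N) (borel R d))).
apply: measurable_funD.
  exact: (measurableT_comp (measurable_message_model kN)
    (measurable_fun_pair (@measurable_fst _ _ (past N) (borel R d)) mh)).
by do 2!(apply: measurable_funM => //); exact: measurable_dot.
Qed.

Lemma integral_message_le (k : 'I_n) :
  (\int[P]_o (message_model k o (message k o))%:E <=
   \int[P]_o (gradient_model k o (gradient k o))%:E)%E.
Proof.
(* This past already contains the stochastic gradient of worker [k], whose rank is one lower. *)
pose N := rank (n := n) t (inl (inr k)).
have kN : (N0 + k.*2 < N)%N by rewrite /N /rank ltn_add2l.
have N0N : (N0 <= N)%N by rewrite /N leq_addr.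
apply: (integral_draw_le freshxi (t := t) (k := inl (inr k)) (N := N)
  (g := fun o => gradient k o - h k o)) => //.
- by apply: borel_measurableB; [exact: adapted_gradient|exact: ah].
- exact: measurable_message_model (ltnW kN).
- exact: message_model_ge0.
- apply: (measurable_past_comp (T := T) (xi := xi) (N := N)).
  exact: (measurableT_comp (measurable_gradient_model (ltnW kN))
    (measurable_fun_pair (@measurable_id _ (past N) setT) (adapted_gradient kN))).
- move=> o; apply: (integral_draw_quadratic_le (F := id)) => //.
  + exact: (CDomega k).1.
  + by rewrite -enorm_sqr; exact: (CDomega k).2.
  + exact: quadratic_message_model.
Qed.

Lemma integral_gradient_le (k : 'I_n) :
  (\int[P]_o (gradient_model k o (gradient k o))%:E <=
   \int[P]_o (partial_model k o)%:E)%E.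
Proof.
pose N := rank (n := n) t (inl (inl k)).
apply: (integral_draw_le freshxi (t := t) (k := inl (inl k)) (N := N) (g := w)) => //.
- by apply: aw; rewrite /N leq_addr.
- exact: measurable_gradient_model.
- exact: gradient_model_ge0.
- exact: measurable_partial_model.
- move=> o; apply: le_trans (integral_draw_quadratic_le (Gmean k) (Gvar k (w o)) _
    (quadratic_gradient_model k o)) _; first by rewrite mulr_ge0// addr_ge0.
  rewrite lee_fin /gradient_model /message_model -/(residual k o).
  rewrite partial_messages_residual /partial_model -/(remaining_noise k o).
  rewrite remaining_noise_next /message_noise le_eqVlt; apply/orP; left.
  by apply/eqP; ring.
Qed.

(** Each step down from [k.+1] to [k] averages the compressor of worker [k], then its stochastic
    gradient. *)
Lemma integral_partial_model_le (k : nat) : (k <= n)%N ->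
  (\int[P]_o (partial_model k o)%:E <= \int[P]_o (partial_model 0 o)%:E)%E.
Proof.
elim: k => [//|k ih kn]; apply: le_trans (ih (ltnW kn)).
apply: le_trans (integral_gradient_le (Ordinal kn)).
apply: le_trans (integral_message_le (Ordinal kn)).
rewrite le_eqVlt; apply/orP; left; apply/eqP; apply: eq_integral => o _.
by rewrite /partial_model (partial_messages_next (Ordinal kn)).
Qed.

Definition next_model o := x o - gamma *: mean_estimate (h ^~ o) (message ^~ o).

Definition next_grad_shift i o := h i o + (1 / (omega + 1)) *: message i o.

Definition next_model_shift o :=
  w o + draw CP (xi t (inr tt) o) (next_model o - w o).

Lemma partial_messagesT o : partial_messages n ^~ o = message ^~ o.
Proof. by apply/funext => i; rewrite /partial_messages ltn_ord. Qed.

Lemma lyapunov_shift (u v : 'rV[R]_d) k :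
  ly u v k = ly u u k + 3 * L / alpha * dot (v - u) (v - u).
Proof. by rewrite /lyapunov subrr dot0l mulr0 addr0. Qed.

(** With [g = u - w], the new shift error is the compression error of [C^P] at [g], so contractivity
    applies directly; no other summand depends on this seed. *)
Lemma integral_compressed_shift_le o :
  (\int[seed_law CP]_s (ly (next_model o)
      (w o + draw CP s (next_model o - w o)) (next_grad_shift ^~ o))%:E <=
   (partial_model n o)%:E)%E.
Proof.
set u := next_model o; set g := u - w o.
have nu0 : 0 <= 3 * L / alpha.
  case/andP: alpha01 => a0 _.
  by rewrite divr_ge0 ?(ltW a0)// mulr_ge0// (smooth_ge0 d0 FL).
have E s : (ly u (w o + draw CP s g) (next_grad_shift ^~ o))%:E =
    ((ly u u (next_grad_shift ^~ o))%:E
     + (3 * L / alpha)%:E * (dot (draw CP s g - g) (draw CP s g - g))%:E)%E.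
  rewrite lyapunov_shift EFinD EFinM.
  have E y : w o + y - u = y - g by rewrite /g [in RHS]opprB addrA [w o + y]addrC.
  by rewrite E.
have mC : measurable_fun [set: seed CP]
    (fun s => dot (draw CP s g - g) (draw CP s g - g)).
  by apply: measurable_dot; apply: borel_measurableB;
    (exact: measurable_draw_at || exact: borel_measurable_cst).
under eq_integral do rewrite E.
rewrite ge0_integralD//; last 3 first.
- by move=> s _; rewrite lee_fin.
- by move=> s _; rewrite -EFinM lee_fin mulr_ge0// dot_ge0.
- by apply: measurable_funeM; exact/measurable_EFinP.
rewrite probability_integral_cst ge0_integralZl_EFin//; last 2 first.
- by move=> s _; rewrite lee_fin dot_ge0.
- exact/measurable_EFinP.
have -> := integral_mean_sq_error CP id g.
apply: (@le_trans _ _ ((ly u u (next_grad_shift ^~ o))%:E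
    + (3 * L / alpha)%:E * ((1 - alpha) * dot g g)%:E)%E).
  by rewrite leeD2l// lee_wpmul2l// ?lee_fin// -enorm_sqr; exact: CPalpha.
rewrite -EFinM -EFinD lee_fin.
have := upper_model_bound gamma alpha omega xs d0 FL mu0 Fmu (x o) (w o) (h ^~ o)
  (message ^~ o).
rewrite -/(next_model o) -/u -/g => /= up_bound.
rewrite /partial_model partial_messagesT big1 ?addr0; last first.
  by move=> i; rewrite leqNgt ltn_ord.
by rewrite lyapunov_shift subrr dot0l mulr0 addr0 in up_bound *;
  rewrite /lyapunov subrr dot0l mulr0 addr0 mulrA.
Qed.

Lemma adapted_next_model N : (N0 + n.*2 <= N)%N ->
  adapted (T := T) xi N next_model.
Proof.
move=> nN; have N0N : (N0 <= N)%N by apply: leq_trans nN; rewrite leq_addr.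
apply: borel_measurableB; first exact: ax.
apply: borel_measurableZ; apply: measurable_mean_estimate => i; first exact: ah.
by apply: adapted_message; apply: leq_trans nN; rewrite ltn_add2l -doubleS leq_double.
Qed.

Lemma adapted_next_grad_shift N i : (N0 + n.*2 <= N)%N ->
  adapted (T := T) xi N (next_grad_shift i).
Proof.
move=> nN; apply: borel_measurableD.
  by apply: ah; apply: leq_trans nN; rewrite leq_addr.
apply: borel_measurableZ; apply: adapted_message; apply: leq_trans nN.
by rewrite ltn_add2l -doubleS leq_double.
Qed.

Lemma adapted_next_model_shift N : (N0 + n.*2 < N)%N ->
  adapted (T := T) xi N next_model_shift.
Proof.
move=> nN; have N0N : (N0 <= N)%N.
  by apply: leq_trans (ltnW nN); rewrite leq_addr.
apply: borel_measurableD; first exact: aw.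
apply: (@adapted_draw _ _ _ _ _ _ _ (source_map G CD CP) xi t (inr tt)) => //.
by apply: borel_measurableB; [exact: adapted_next_model (ltnW nN)|exact: aw].
Qed.

Lemma lyapunov_step :
  (\int[P]_o (ly (next_model o) (next_model_shift o) (next_grad_shift ^~ o))%:E <=
   (1 - gamma * mu / 2)%:E * \int[P]_o (ly (x o) (w o) (h ^~ o))%:E
   + (12 * gamma * (omega + 1) * sigma ^+ 2 / n%:R)%:E)%E.
Proof.
pose N := rank (n := n) t (inr tt).
have N0N : (N0 <= N)%N by rewrite /N leq_addr.
have anext : adapted (T := T) xi N next_model by exact: adapted_next_model.
apply: le_trans (_ : (\int[P]_o (partial_model n o)%:E <= _)%E).
  apply: (integral_draw_le freshxi (t := t) (k := inr tt) (N := N)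
    (g := fun o => next_model o - w o)
    (q := fun o y => ly (next_model o) (w o + y) (next_grad_shift ^~ o))) => //.
  - by apply: borel_measurableB => //; exact: aw.
  - have mfst (u : O -> 'rV[R]_d) : adapted (T := T) xi N u ->
      measurable_fun [set: past N * borel R d] (fun p => u p.1 : borel R d).
      by move=> au; exact: (measurableT_comp au (@measurable_fst _ _ (past N) (borel R d))).
    apply: (@measurable_lyapunov R n d f L gamma alpha omega xs FL _
      (past N * borel R d)%type (fun p => next_model p.1) (fun p => w p.1 + p.2)
      (fun i p => next_grad_shift i p.1)).
    + exact: mfst anext.
    + apply: borel_measurableD; first exact: mfst (aw N0N).
      exact: measurable_snd.
    + by move=> i; apply: mfst; exact: adapted_next_grad_shift.
  - exact: measurable_partial_model.
  - exact: integral_compressed_shift_le.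
apply: le_trans (integral_partial_model_le (leqnn n)) _.
have rho0 : 0 <= 1 - gamma * mu / 2.
  have : gamma * mu <= 1.
    apply: le_trans gammamu; rewrite ler_peMr ?lerDr//.
    by rewrite mulr_ge0// ltW.
  lra.
have c0 : 0 <= 12 * gamma * (omega + 1) * sigma ^+ 2 / n%:R.
  by rewrite divr_ge0// mulr_ge0 ?sqr_ge0// mulr_ge0 ?addr_ge0// mulr_ge0// ltW.
have mly : measurable_fun [set: O] (fun o => ly (x o) (w o) (h ^~ o)).
  apply: (measurable_past_comp (T := T) (xi := xi) (N := N)).
  by apply: measurable_lyapunov => //; [exact: ax|exact: aw|move=> i; exact: ah].
rewrite -ge0_integralZl_EFin//; last 2 first.
- by move=> o _; rewrite lee_fin.
- exact/measurable_EFinP.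
(* The constant noise becomes an integral too, so that a pointwise comparison of integrands
   suffices. *)
rewrite -[X in (_ + X)%E](probability_integral_cst P) -ge0_integralD//; last 2 first.
- by move=> o _; rewrite -EFinM lee_fin mulr_ge0.
- by apply: measurable_funeM; exact/measurable_EFinP.
apply: ge0_le_integral => //.
- by move=> o _; rewrite lee_fin partial_model_ge0.
- exact/measurable_EFinP/measurable_partial_model.
- apply: emeasurable_funD => //.
  by apply: measurable_funeM; exact/measurable_EFinP.
- move=> o _; rewrite -EFinM -EFinD lee_fin.
  exact: (expected_upper_model_le sigma n0 d0 fdiff FL fL fconv mu0 Fmu Fmin omega0
    alpha01 gamma0 gammaLi gammaL gammamu (x o) (w o) (h ^~ o)).
Qed.

End OneIteration.

(** * Trajectory *)

Section Trajectory.
Context {R : realType} {n d T : nat} {dO : measure_display}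
  {O : measurableType dO} {P : probability O R}.
Context (gamma omega : R) (G CD : 'I_n -> stoch_map R d) (CP : stoch_map R d)
  (xi : nat -> forall k : source n, {RV P >-> seed (source_map G CD CP k)})
  (x0 : 'rV[R]_d) (h0 : 'I_n -> 'rV[R]_d).

Local Notation run := (diana gamma (1 / (omega + 1)) xi x0 h0).

Definition models t o := model (run t o).
Definition model_shifts t o := model_shift (run t o).
Definition grad_shifts t i o := grad_shift (run t o) i.

(** Both sides follow the same linear recursion; hence [mean_estimate] is the estimator used by the
    algorithm. *)
Lemma mean_shift_diana t o :
  mean_shift (run t o) = n%:R^-1 *: \sum_i grad_shift (run t o) i.
Proof.
elim: t => [//|t ih] /=; rewrite ih big_split /= scalerDr; congr (_ + _).
by rewrite -scaler_sumr !scalerA mulrC.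
Qed.

Lemma models_next t : models t.+1 =
  next_model gamma xi t (models t) (model_shifts t) (grad_shifts t).
Proof. by apply/funext => o; rewrite /models /= mean_shift_diana. Qed.

Lemma grad_shifts_next t : grad_shifts t.+1 =
  next_grad_shift omega xi t (model_shifts t) (grad_shifts t).
Proof. by []. Qed.

Lemma model_shifts_next t : model_shifts t.+1 =
  next_model_shift gamma xi t (models t) (model_shifts t) (grad_shifts t).
Proof.
apply/funext => o; rewrite /next_model_shift -models_next.
by rewrite /model_shifts /models.
Qed.

Lemma adapted_diana t : (t <= T)%N -> forall N, (t * n.*2.+1 <= N)%N ->
  [/\ adapted (T := T) xi N (models t), adapted (T := T) xi N (model_shifts t)
    & forall i, adapted (T := T) xi N (grad_shifts t i)].
Proof.
elim: t => [_ N _|t ih tT N tN].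
  by split=> [||i]; exact: borel_measurable_cst.
have {}ih := ih (ltnW tT).
have ax N' (h : (t * n.*2.+1 <= N')%N) : adapted (T := T) xi N' (models t).
  by have [] := ih N' h.
have aw N' (h : (t * n.*2.+1 <= N')%N) : adapted (T := T) xi N' (model_shifts t).
  by have [] := ih N' h.
have ah N' i (h : (t * n.*2.+1 <= N')%N) : adapted (T := T) xi N' (grad_shifts t i).
  by have [_ _] := ih N' h; exact.
(* The left side is the rank of the seed of [C^P], the last of iteration [t], so the inequality must
   be strict. *)
have ltN : (t * n.*2.+1 + n.*2 < N)%N by rewrite -addnS addnC -mulSn.
have leN := ltnW ltN.
split=> [||i].
- by rewrite models_next; exact: (adapted_next_model gamma tT ax aw ah leN).
- rewrite model_shifts_next.
  exact: (adapted_next_model_shift gamma tT ax aw ah ltN).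
- by rewrite grad_shifts_next; exact: (adapted_next_grad_shift omega tT aw ah i leN).
Qed.

End Trajectory.

Lemma le_ubfrac {R : realType} (g a b : R) : 0 <= a -> 0 <= b ->
  (g%:E <= ubfrac a b)%E -> g * b <= a.
Proof.
move=> a0 b0; rewrite /ubfrac; have [->|bn0] := eqVneq b 0; first by rewrite mulr0.
by rewrite lee_fin ler_pdivlMr// lt_neqAle eq_sym bn0.
Qed.

Theorem theorem5p3 (R : realType) (n d : nat) (hn : (0 < n)%N) (hd : (0 < d)%N)
  (f : 'I_n -> 'rV[R]_d -> R) (L mu : R) (Li : 'I_n -> R) (xstar : 'rV[R]_d)
  (hfdiff : forall i, differentiable_everywhere (f i))
  (hL : smoothness_constant L (average f))
  (hLi : forall i, smoothness_constant (Li i) (f i))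
  (hconv : forall i, convex_function [set: 'rV[R]_d] (f i))
  (hmu : 0 <= mu) (hstrong : strongly_convex mu (average f))
  (hmin : forall x, average f xstar <= average f x)
  (sigma : R) (G : 'I_n -> stoch_map R d)
  (hGmean : forall i, unbiased (G i) (grad (f i)))
  (hGvar : forall i x, (mean_sq_error (G i) (grad (f i)) x <= (sigma ^+ 2)%:E)%E)
  (omega alpha : R) (homega : 0 <= omega) (halpha : 0 < alpha <= 1)
  (CD : 'I_n -> stoch_map R d) (hCD : forall i, unbiased_compressor omega (CD i))
  (CP : stoch_map R d) (hCP : contractive alpha CP)
  (T : nat) (dO : measure_display) (O : measurableType dO) (P : probability O R)
  (xi : nat -> forall k : source n, {RV P >-> seed (source_map G CD CP k)})
  (hxi : fresh_seeds T xi)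
  (x0 : 'rV[R]_d) (h0 : 'I_n -> 'rV[R]_d) (gamma beta : R)
  (hbeta : beta = 1 / (omega + 1)) (hgamma : 0 < gamma)
  (hgamma_le :
    let Lmax := \big[Num.max/0]_(i < n) Li i in
    (gamma%:E <= mine (mine (ubfrac n%:R (160 * omega * Lmax))
                            (ubfrac alpha (100 * L)))
                      (ubfrac 1 ((omega + 1) * mu)))%E) :
  let xT := fun o : O => model (diana gamma beta xi x0 h0 T o) in
  let V0 : \bar R :=
    ((1 / (2 * gamma))%:E * 'E_P[fun _ : O => (enorm (x0 - xstar) ^+ 2)%R]
     + (average f x0 - average f xstar)%:E
     + (8 * gamma * omega * (omega + 1) / n%:R ^+ 2
        * \sum_(i < n) enorm (h0 i - grad (f i) xstar) ^+ 2)%:E)%E in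
  ((1 / (2 * gamma))%:E * 'E_P[fun o => (enorm (xT o - xstar) ^+ 2)%R]
   + 'E_P[fun o => (average f (xT o) - average f xstar)%R]
   <= ((1 - gamma * mu / 2) ^+ T)%:E * V0
      + ubfrac (24 * (omega + 1) * sigma ^+ 2) (mu * n%:R))%E.
Proof.
subst beta; lazy zeta in hgamma_le |- *.
pose xT := models gamma omega xi x0 h0 T.
have L0 := smooth_ge0 hd hL.1.
have Li0 i := smooth_ge0 hd (hLi i).1.
case/andP: (halpha) => alpha0 alpha1.
have o1 : 0 < omega + 1 by rewrite ltr_pwDr.
have N0 : 0 < n%:R :> R by rewrite ltr0n.
pose K := 8 * gamma * omega * (omega + 1) / n%:R ^+ 2.
pose v0 := (2 * gamma)^-1 * dot (x0 - xstar) (x0 - xstar)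
  + (average f x0 - average f xstar) + K * shift_error f xstar h0.
rewrite (_ : (_ + _ + _)%E = v0%:E); last first.
  rewrite expectation_cst enorm_sqr div1r -EFinM -!EFinD /v0 /shift_error.
  by under eq_bigr do rewrite enorm_sqr.
rewrite -EFinM.
(* A zero denominator makes the right-hand side infinite. *)
have [mu0|mun0] := eqVneq mu 0.
  by rewrite /ubfrac mu0 mul0r eqxx addey// leey.
have {mun0 hmu}mu0 : 0 < mu by rewrite lt_neqAle eq_sym mun0.
rewrite /ubfrac mulf_eq0 (gt_eqF mu0) (gt_eqF N0) /= -EFinD.
move: hgamma_le; set Lmax := \big[_/_]_(_ | _) _.
rewrite !le_min => /andP[/andP[gLi gL] gmu].
(* The default 0 of the maximum is harmless: every [Li i] is nonnegative. *)
have Lmax_ge i : Li i <= Lmax by exact: le_bigmax.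
have Lmax0 : 0 <= Lmax by exact: bigmax_ge_id.
have gammaLi i : 160 * gamma * omega * Li i <= n%:R.
  have := le_ubfrac (ltW N0) _ gLi; rewrite !mulr_ge0// => /(_ isT).
  apply: le_trans; rewrite (_ : 160 * gamma * omega * Li i =
    gamma * (160 * omega * Li i)); last by ring.
  by rewrite ler_wpM2l ?(ltW hgamma)// ler_wpM2l// mulr_ge0.
have gammaL : 100 * gamma * L <= alpha.
  have := le_ubfrac (ltW alpha0) _ gL; rewrite mulr_ge0// => /(_ isT).
  by rewrite mulrCA mulrA.
have gammamu : gamma * mu * (omega + 1) <= 1.
  have := le_ubfrac ler01 (mulr_ge0 (ltW o1) (ltW mu0)) gmu.
  by rewrite mulrA mulrAC.
have fconv i := convex_function_strongly_convex0 (hconv i).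
have fL i := (hLi i).1.
pose ly t o := lyapunov f L gamma alpha omega xstar
  (models gamma omega xi x0 h0 t o) (model_shifts gamma omega xi x0 h0 t o)
  (grad_shifts gamma omega xi x0 h0 t ^~ o).
(* The fixed point of the affine recursion: [gamma * mu / 2 * c] is exactly the noise added in one
   iteration. *)
pose c := 24 * (omega + 1) * sigma ^+ 2 / (mu * n%:R).
have rho0 : 0 <= 1 - gamma * mu / 2.
  have : gamma * mu <= 1.
    apply: le_trans gammamu; rewrite ler_peMr ?lerDr//.
    by rewrite mulr_ge0// ltW.
  lra.
have lyE t : (t <= T)%N ->
    (\int[P]_o (ly t o)%:E <= ((1 - gamma * mu / 2) ^+ t * v0 + c)%:E)%E.
  elim: t => [_|t ih tT].
    rewrite (_ : (\int[P]_o _)%E = (\int[P]_o v0%:E)%E); last first.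
      by apply: eq_integral => o _; rewrite /ly /lyapunov subrr dot0l mulr0 addr0.
    rewrite probability_integral_cst lee_fin expr0 mul1r lerDl /c divr_ge0//.
      by rewrite mulr_ge0 ?sqr_ge0// mulr_ge0// ltW.
    by rewrite mulr_ge0// ltW.
  have ax N' (h : (t * n.*2.+1 <= N')%N) :
      adapted (T := T) xi N' (models gamma omega xi x0 h0 t).
    by have [] := adapted_diana gamma omega xi x0 h0 (ltnW tT) h.
  have aw N' (h : (t * n.*2.+1 <= N')%N) :
      adapted (T := T) xi N' (model_shifts gamma omega xi x0 h0 t).
    by have [] := adapted_diana gamma omega xi x0 h0 (ltnW tT) h.
  have ah N' i (h : (t * n.*2.+1 <= N')%N) :
      adapted (T := T) xi N' (grad_shifts gamma omega xi x0 h0 t i).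
    by have [_ _] := adapted_diana gamma omega xi x0 h0 (ltnW tT) h; exact.
  have := lyapunov_step hn hd hfdiff hL.1 fL fconv mu0 hstrong hmin homega halpha
    hgamma gammaLi gammaL gammamu hGmean hGvar hCD hCP hxi tT ax aw ah.
  under eq_integral do rewrite -models_next -model_shifts_next -grad_shifts_next.
  move=> /le_trans; apply.
  apply: (@le_trans _ _ ((1 - gamma * mu / 2)%:E
    * ((1 - gamma * mu / 2) ^+ t * v0 + c)%:E
    + (12 * gamma * (omega + 1) * sigma ^+ 2 / n%:R)%:E)%E).
    by rewrite leeD2r// lee_wpmul2l ?lee_fin//; exact: ih (ltnW tT).
  rewrite -EFinM -EFinD lee_fin (exprS _ t) le_eqVlt; apply/orP; left; apply/eqP.
  by rewrite /c; move: (_ ^+ t) => r; field; rewrite !gt_eqF.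
(* What remains is the pointwise bound [lyapunov_ge], once the two expectations are merged into one
   integral of nonnegative functions. *)
apply: le_trans (lyE T (leqnn T)).
have [aT _ _] := adapted_diana gamma omega xi x0 h0 (leqnn T) (leqnn _).
have mT := adapted_measurable aT.
have mD : measurable_fun [set: O] (fun o => dot (xT o - xstar) (xT o - xstar)).
  by apply: measurable_dot; apply: borel_measurableB => //;
    exact: borel_measurable_cst.
have mF : measurable_fun [set: O] (fun o => average f (xT o) - average f xstar).
  apply: measurable_funB => //.
  exact: (measurableT_comp (measurable_differentiable hL.1.1) mT).
rewrite unlock; under eq_integral do rewrite enorm_sqr.
rewrite div1r -ge0_integralZl_EFin//; last 3 first.
- by move=> o _; rewrite lee_fin dot_ge0.
- exact/measurable_EFinP.
- by rewrite invr_ge0 mulr_ge0// ltW.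
rewrite -ge0_integralD//; last 4 first.
- by move=> o _; rewrite -EFinM lee_fin mulr_ge0 ?dot_ge0// invr_ge0 mulr_ge0// ltW.
- by apply: measurable_funeM; exact/measurable_EFinP.
- by move=> o _; rewrite lee_fin subr_ge0.
- exact/measurable_EFinP.
apply: ge0_le_integral => //.
- move=> o _; rewrite -EFinM -EFinD lee_fin addr_ge0 ?subr_ge0//.
  by rewrite mulr_ge0 ?dot_ge0// invr_ge0 mulr_ge0// ltW.
- apply: emeasurable_funD; last exact/measurable_EFinP.
  by apply: measurable_funeM; exact/measurable_EFinP.
- apply/measurable_EFinP.
  pose N' := (T * n.*2.+1)%N.
  have [a1 a2 a3] := adapted_diana gamma omega xi x0 h0 (leqnn T) (leqnn N').
  apply: (measurable_past_comp (T := T) (xi := xi) (N := N')).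
  exact: (measurable_lyapunov gamma alpha omega xstar hL.1 a1 a2 a3).
- move=> o _; rewrite -EFinM -EFinD lee_fin.
  exact: (lyapunov_ge xstar hd hL.1 mu0 hstrong homega halpha hgamma).
Qed.
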